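(* Let $\mathfrak{g}$ be a $6$-dimensional strongly unimodular almost nilpotent real Lie algebra with nilradical $\mathfrak{n}$ satisfying $\dim\mathfrak{n}^1=1$, where $\mathfrak{n}^1=[\mathfrak{n},\mathfrak{n}]$. Then $\mathfrak{g}$ admits complex structures $J$ satisfying $J\mathfrak{n}^1\subset\mathfrak{n}$ if and only if it is isomorphic to one of the following: - $\mathfrak{s}_{4.6}\oplus\mathbb{R}^2=(f^{23},f^{26},-f^{36},0,0,0)$, with $Jf_1=f_2$, $Jf_3=f_6$, $Jf_4=f_5$, - $\mathfrak{s}_{4.7}\oplus\mathbb{R}^2=(f^{23},f^{36},-f^{26},0,0,0)$, with $Jf_1=f_4$, $Jf_2=f_3$, $Jf_5=f_6$, - $\mathfrak{s}_{5.16}\oplus\mathbb{R}=(f^{23}+f^{46},f^{36},-f^{26},0,0,0)$, with $Jf_1=-f_5$, $Jf_2=f_3$, $Jf_4=f_6$, - $\mathfrak{s}_{6.25}=(f^{23},f^{36},-f^{26},0,f^{46},0)$, with $Jf_1=-f_5$, $Jf_2=f_3$, $Jf_4=f_6$, - $\mathfrak{s}_{6.51}^{a,0}=(f^{23},af^{26},-af^{36},f^{56},-f^{46},0)$, $a>0$, with $Jf_1=af_2$, $Jf_3=f_6$, $Jf_4=f_5$, - $\mathfrak{s}_{6.158}=(f^{24}+f^{35},0,f^{36},0,-f^{56},0)$, with $Jf_1=f_3$, $Jf_2=f_4$, $Jf_5=f_6$, - $\mathfrak{s}_{6.164}^a=(f^{24}+f^{35},af^{26},f^{56},-af^{46},-f^{36},0)$,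 $a>0$, with $Jf_1=af_2$, $Jf_3=f_5$, $Jf_4=f_6$. For each of these Lie algebras, the indicated $J$ is an explicit example of a complex structure satisfying $J\mathfrak{n}^1\subset\mathfrak{n}$.
   Context: The nilradical $\mathfrak{n}$ of a solvable Lie algebra $\mathfrak{g}$ is its maximal nilpotent ideal; $\mathfrak{g}$ is almost nilpotent if it is solvable and $\mathfrak{n}$ has codimension one. With $\mathfrak{n}^0=\mathfrak{n}$, $\mathfrak{n}^{l}=[\mathfrak{n},\mathfrak{n}^{l-1}]$, a solvable $\mathfrak{g}$ is strongly unimodular if $\operatorname{tr}(\mathrm{ad}_X|_{\mathfrak{n}^l/\mathfrak{n}^{l+1}})=0$ for all $X\in\mathfrak{g}$ and all $l\in\mathbb{N}$. Structure equations: $(\phi_1,\dots,\phi_6)$ denotes the Lie algebra with a basis $\{f_1,\dots,f_6\}$ whose dual basis satisfies $df^k=\phi_k$, where $f^{kl}=f^k\wedge f^l$ and $d\alpha(X,Y)=-\alpha([X,Y])$. A complex structure on $\mathfrak{g}$ is an endomorphism $J$ with $J^2=-\mathrm{Id}$ and $[JX,JY]-J[JX,Y]-J[X,JY]-[X,Y]=0$ for all $X,Y$. *)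

(* Defs.v *)
From HB Require Import structures.
From mathcomp Require Import all_boot all_order all_algebra.
From mathcomp Require Import ring zify.
From mathcomp Require Import boolp reals.

Set Implicit Arguments.
Unset Strict Implicit.
Unset Printing Implicit Defensive.

Import Order.TTheory GRing.Theory Num.Theory.
Local Open Scope ring_scope.

HB.mixin Record Vector_isLieAlgebra (R : fieldType) V of Vector R V := {
  bracket : V -> V -> V;
  bracket_linearl : forall y : V, linear (fun x => bracket x y);
  bracket_linearr : forall x : V, linear (bracket x);
  bracketxx : forall x : V, bracket x x = 0;
  bracket_jacobi : forall x y z : V,
    bracket x (bracket y z) + bracket y (bracket z x)
    + bracket z (bracket x y) = 0
}.

#[short(type="lieAlgType")]
HB.structure Definition LieAlgebra (R : fieldType) :=
  {V of Vector R V & Vector_isLieAlgebra R V}.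

Section LieTheory.
Variables (R : fieldType) (g : lieAlgType R).
Implicit Types (x y z : g) (U W X I m n : {vspace g}).

HB.instance Definition _ x :=
  @GRing.isLinear.Build R g g *:%R (bracket x) (bracket_linearr x).

(* By bilinearity, the span of all brackets [u, w] with u in U, w in W; the
   encoding is the one of [prodv] in falgebra. See [lievP]. *)
Definition liev U W : {vspace g} :=
  <<allpairs bracket (vbasis U) (vbasis W)>>%VS.

Definition is_ideal I : Prop := forall x y, y \in I -> bracket x y \in I.

Definition lcs n (l : nat) : {vspace g} := iter l (liev n) n.

Definition derived_series (l : nat) : {vspace g} :=
  iter l (fun U => liev U U) fullv.

Definition solvable : Prop := exists l, derived_series l = 0%VS.

Definition nilpotent n : Prop := exists l, lcs n l = 0%VS.

Definition is_nilradical n : Prop :=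
  [/\ is_ideal n, nilpotent n &
      forall m, is_ideal m -> nilpotent m -> (m <= n)%VS].

(* The trace of the endomorphism of U / W induced by f, for W included in U
   and f stabilising both: the classes of the vectors of a basis b of a
   complement of W in U form a basis of U / W, and the matrix below is the
   matrix of the induced endomorphism in this basis, i.e.
   f b_j = \sum_i A i j b_i modulo W. *)
Definition quotient_trace (f : g -> g) U W : R :=
  let b := vbasis (U :\: W) in
  let bw := cat_tuple b (vbasis W) in
  \tr (\matrix_(i, j) coord bw (lshift (\dim W) i) (f (tnth b j))).

Definition complex_structure (J : 'End(g)) : Prop :=
  (forall x, J (J x) = - x) /\
  (forall x y, bracket (J x) (J y) - J (bracket (J x) y)
               - J (bracket x (J y)) - bracket x y = 0).

Lemma lievP U W X :
  reflect {in U & W, forall u w, bracket u w \in X} (liev U W <= X)%VS.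
Proof.
apply: (iffP span_subvP) => [sX u w uU wW | sX _ /allpairsP[[u w] /= [uU wW ->]]].
  rewrite (coord_vbasis uU) (coord_vbasis wW).
  rewrite linear_sum /= memv_suml // => j _; rewrite linearZ /= memvZ //.
  set b := (vbasis W)`_j.
  have -> : bracket (\sum_i coord (vbasis U) i u *: (vbasis U)`_i) b
          = \sum_i coord (vbasis U) i u *: bracket (vbasis U)`_i b.
    pose h := GRing.isLinear.Build R g g *:%R (fun x => bracket x b)
       (bracket_linearl b).
    pose f : {linear g -> g} := HB.pack (fun x => bracket x b) h.
    by rewrite -[LHS]/(f _) linear_sum; apply: eq_bigr => i _; rewrite linearZ.
  rewrite memv_suml // => i _; rewrite memvZ // sX //.
  by apply/allpairsP; exists ((vbasis U)`_i, b); rewrite !mem_nth // size_tuple.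
by apply: sX; apply: vbasis_mem.
Qed.

Lemma bracketDl x y z : bracket (x + y) z = bracket x z + bracket y z.
Proof. by have := bracket_linearl z 1 x y; rewrite !scale1r. Qed.

Lemma bracketC x y : bracket x y = - bracket y x.
Proof.
have := bracketxx (x + y); rewrite bracketDl !raddfD /= !bracketxx add0r addr0.
by move/eqP; rewrite addr_eq0 => /eqP.
Qed.

Lemma mem_liev U W u w : u \in U -> w \in W -> bracket u w \in liev U W.
Proof. by move=> uU wW; apply: (lievP U W _ (subvv _)). Qed.

Lemma is_ideal_liev U W : is_ideal U -> is_ideal W -> is_ideal (liev U W).
Proof.
move=> iU iW x.
suff /subvP s : (liev U W <= linfun (bracket x) @^-1: liev U W)%VS.
  by move=> y /s; rewrite -memv_preim lfunE.
apply/lievP => u w uU wW; rewrite -memv_preim lfunE /=.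
have := bracket_jacobi x u w.
move/eqP; rewrite -addrA addr_eq0 => /eqP ->.
rewrite memvN memvD //.
  by rewrite mem_liev // bracketC memvN iW.
by rewrite bracketC memvN mem_liev // iU.
Qed.

Lemma is_ideal_lcs n l : is_ideal n -> is_ideal (lcs n l).
Proof. by move=> ni; elim: l => [|l IH] //=; apply: is_ideal_liev. Qed.

Lemma is_ideal_add m n : is_ideal m -> is_ideal n -> is_ideal (m + n)%VS.
Proof.
move=> im jn x _ /memv_addP[u um [v vn ->]].
by rewrite linearD /= memv_add ?im ?jn.
Qed.

Lemma nilpotent_add m n : is_ideal m -> is_ideal n ->
  nilpotent m -> nilpotent n -> nilpotent (m + n)%VS.
Proof.
pose M a i := if i is i'.+1 then lcs a i' else fullv.
have MS a i : is_ideal a -> (liev a (M a i) <= M a i.+1)%VS.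
  case: i => [|i] // ia; apply/lievP => u w ua _.
  by rewrite bracketC memvN; apply: ia.
have iM a i : is_ideal a -> is_ideal (M a i).
  by case: i => [|i] ia; [move=> *; rewrite memvf | apply: is_ideal_lcs].
have M0 a i j : lcs a i = 0%VS -> (i < j)%N -> M a j = 0%VS.
  move=> ai; case: j => [//|j]; rewrite ltnS => /subnK <-.
  elim: (j - i)%N => [//|k IH] /=; apply/eqP; rewrite -subv0.
  apply/lievP => u w _; move: IH => /= ->.
  by rewrite memv0 => /eqP ->; rewrite linear0 mem0v.
move=> im jn [p mp] [q nq]; exists (p + q).+1.
pose S s := (\sum_(i < s.+1) (M m i :&: M n (s - i)%N))%VS.
have sS s i j : (i + j = s)%N -> (M m i :&: M n j <= S s)%VS.
  move=> <-; have li : (i < (i + j).+1)%N by rewrite ltnS leq_addr.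
  by apply: (sumv_sup (Ordinal li)) => //=; rewrite addKn.
suff lS s : (lcs (m + n) s <= S s.+1)%VS.
  apply/eqP; rewrite -subv0 (subv_trans (lS _)) //; apply/subv_sumP => i _.
  case: (ltnP p i) => [pi | ip]; first by rewrite (M0 _ _ _ mp pi) cap0v.
  rewrite (M0 _ _ _ nq) ?capv0 // ltn_subRL; lia.
elim: s => [|s IH].
  rewrite subv_add; apply/andP; split.
    by apply: subv_trans (sS 1%N 1%N 0%N erefl); rewrite capvf.
  by apply: subv_trans (sS 1%N 0%N 1%N erefl); rewrite capfv.
rewrite [lcs _ _]/=; apply/lievP => u w umn /(subvP IH).
move=> /memv_sumP[v vS ->]; rewrite linear_sum /= memv_suml // => i _.
have := vS i isT; rewrite memv_cap => /andP[vm vn].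
move: umn => /memv_addP[u1 u1m [u2 u2n ->]].
rewrite bracketDl memvD //.
  apply: (subvP (sS s.+2 i.+1 (s.+1 - i)%N _)); first by have := ltn_ord i; lia.
  rewrite memv_cap (subvP (MS _ _ im)) ?mem_liev //=.
  exact: (iM n (s.+1 - i)%N jn).
apply: (subvP (sS s.+2 i (s.+1 - i).+1 _)); first by have := ltn_ord i; lia.
rewrite memv_cap [X in _ && X](subvP (MS _ _ jn)) ?mem_liev // andbT.
exact: (iM m i im).
Qed.

Lemma nilradical_exists : exists n, is_nilradical n.
Proof.
pose P d := `[< exists n, [/\ is_ideal n, nilpotent n & \dim n = d] >].
have P0 : exists d, P d.
  exists 0%N; apply/asboolP; exists 0%VS; split; last exact: dimv0.
    by move=> x y; rewrite !memv0 => /eqP ->; rewrite linear0.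
  by exists 0%N.
have Pb d : P d -> (d <= \dim {:g})%N.
  by move=> /asboolP[n [_ _ <-]]; rewrite dimvS ?subvf.
case: (ex_maxnP P0 Pb) => d /asboolP[n [ni nn <-]] dmax.
exists n; split=> // m im nm.
suff /eqP -> : n == (m + n)%VS by rewrite addvSl.
rewrite eqEdim addvSr dmax //; apply/asboolP; exists (m + n)%VS.
by split=> //; [apply: is_ideal_add | apply: nilpotent_add].
Qed.

End LieTheory.

Arguments derived_series {R} g l.
Arguments solvable {R} g.

Section Nilradical.
Variables (R : fieldType) (g : lieAlgType R).

Definition nilradical : {vspace g} := sval (cid (nilradical_exists g)).

Lemma nilradicalP : is_nilradical nilradical.
Proof. exact: svalP (cid (nilradical_exists g)). Qed.

Definition almost_nilpotent : Prop :=
  solvable g /\ \dim {:g} = (\dim nilradical).+1.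

Definition strongly_unimodular : Prop :=
  solvable g /\
  forall (x : g) (l : nat),
    quotient_trace (bracket x) (lcs nilradical l) (lcs nilradical l.+1) = 0.

(* A complex structure J such that J n^1 is included in n. *)
Definition adapted_complex_structure (J : 'End(g)) : Prop :=
  complex_structure J /\ (J @: lcs nilradical 1 <= nilradical)%VS.

End Nilradical.

Arguments nilradical {R} g.
Arguments almost_nilpotent {R} g.
Arguments strongly_unimodular {R} g.

Definition lie_isomorphic (R : fieldType) (g h : lieAlgType R) : Prop :=
  exists f : 'Hom(g, h),
    bijective f /\ forall x y, f (bracket x y) = bracket (f x) (f y).

Section StructureEquations.
Variable R : fieldType.

(* A 2-form on R^6 is represented by its Gram matrix in the standard basis,
   and wedge k l is the 2-form f^k /\ f^l, with indices starting at 1;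
   see [wedgeE]. *)
Definition wedge (k l : nat) : 'M[R]_6 :=
  delta_mx (inord k.-1) (inord l.-1) - delta_mx (inord l.-1) (inord k.-1).

Definition form_eval (w : 'M[R]_6) (x y : 'rV[R]_6) : R :=
  (x *m w *m y^T) 0 0.

(* The bracket on R^6 such that d f^k (x, y) = - f^k [x, y] is the k-th entry
   of phi, for (f^1, ..., f^6) the dual of the standard basis. *)
Definition str_bracket (phi : seq 'M[R]_6) (x y : 'rV[R]_6) : 'rV[R]_6 :=
  \row_k - form_eval phi`_k x y.

Definition is_str_eqs (phi : seq 'M[R]_6) : Prop :=
  let br := str_bracket phi in
  (forall x, br x x = 0) /\
  (forall x y z, br x (br y z) + br y (br z x) + br z (br x y) = 0).

Lemma form_evalD v w x y :
  form_eval (v + w) x y = form_eval v x y + form_eval w x y.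
Proof. by rewrite /form_eval mulmxDr mulmxDl mxE. Qed.

Lemma form_evalN w x y : form_eval (- w) x y = - form_eval w x y.
Proof. by rewrite /form_eval mulmxN mulNmx mxE. Qed.

Lemma form_evalZ a w x y : form_eval (a *: w) x y = a * form_eval w x y.
Proof. by rewrite /form_eval -scalemxAr -scalemxAl mxE. Qed.

Lemma form_eval0 x y : form_eval 0 x y = 0.
Proof. by rewrite /form_eval mulmx0 mul0mx mxE. Qed.

Lemma wedgeE k l x y : form_eval (wedge k l) x y =
  x 0 (inord k.-1) * y 0 (inord l.-1) - x 0 (inord l.-1) * y 0 (inord k.-1).
Proof.
have dE i j : form_eval (delta_mx i j) x y = x 0 i * y 0 j.
  rewrite /form_eval mxE (bigD1 j) //= big1 ?addr0 => [|k' /negPf k'j].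
    rewrite !mxE (bigD1 i) //= big1 ?addr0 => [|k' /negPf k'i].
      by rewrite !mxE !eqxx mulr1.
    by rewrite mxE k'i mulr0.
  rewrite mxE big1 ?mul0r // => i' _; rewrite mxE k'j andbF mulr0 //.
by rewrite /wedge form_evalD form_evalN !dE.
Qed.

Lemma str_bracketE phi x y k : (k < 6)%N ->
  str_bracket phi x y 0 (inord k) = - form_eval phi`_k x y.
Proof. by move=> k6; rewrite mxE inordK. Qed.

Lemma eq_row6 (u v : 'rV[R]_6) :
  (forall k, (k < 6)%N -> u 0 (inord k) = v 0 (inord k)) -> u = v.
Proof. by move=> uv; apply/rowP => k; rewrite -(inord_val k) uv. Qed.

Lemma rowDE (u v : 'rV[R]_6) i : (u + v) 0 i = u 0 i + v 0 i.
Proof. by rewrite mxE. Qed.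

Lemma row0E i : (0 : 'rV[R]_6) 0 i = 0.
Proof. by rewrite mxE. Qed.

Lemma str_bracket_linearr phi x : linear (str_bracket phi x).
Proof.
move=> a y z; apply/rowP => k; rewrite !mxE /form_eval.
by rewrite linearP /= mulmxDr -scalemxAr !mxE opprD mulrN.
Qed.

Lemma str_bracket_linearl phi y : linear (str_bracket phi ^~ y).
Proof.
move=> a x z; apply/rowP => k; rewrite !mxE /form_eval.
by rewrite !mulmxDl -!scalemxAl !mxE opprD mulrN.
Qed.

Definition lie_of (phi : seq 'M[R]_6) (phiP : is_str_eqs phi) : Type :=
  'rV[R]_6.

HB.instance Definition _ phi (phiP : is_str_eqs phi) :=
  Vector.copy (lie_of phiP) 'rV[R]_6.

HB.instance Definition _ phi (phiP : is_str_eqs phi) :=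
  Vector_isLieAlgebra.Build R (lie_of phiP)
    (str_bracket_linearl phi) (str_bracket_linearr phi)
    phiP.1 phiP.2.

(* The basis vector f_k, with k between 1 and 6. *)
Definition f_ (k : nat) : 'rV[R]_6 := delta_mx 0 (inord k.-1).

End StructureEquations.

Arguments f_ {R} k.
Arguments wedge {R} k l.

Ltac prove_str_eqs :=
  split=> [x | x y z]; apply: eq_row6; do 6?[case=> [_|]]; move=> //;
  rewrite ?(rowDE, row0E);
  do 2!rewrite ?str_bracketE //=
    ?(form_evalD, form_evalN, form_evalZ, form_eval0, wedgeE) /=;
  ring.

Section Algebras.
Variables (R : fieldType) (a : R).

Definition eqs_4_6 : seq 'M[R]_6 :=
  [:: wedge 2 3; wedge 2 6; - wedge 3 6; 0; 0; 0].

Definition eqs_4_7 : seq 'M[R]_6 :=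
  [:: wedge 2 3; wedge 3 6; - wedge 2 6; 0; 0; 0].

Definition eqs_5_16 : seq 'M[R]_6 :=
  [:: wedge 2 3 + wedge 4 6; wedge 3 6; - wedge 2 6; 0; 0; 0].

Definition eqs_6_25 : seq 'M[R]_6 :=
  [:: wedge 2 3; wedge 3 6; - wedge 2 6; 0; wedge 4 6; 0].

Definition eqs_6_51 : seq 'M[R]_6 :=
  [:: wedge 2 3; a *: wedge 2 6; - (a *: wedge 3 6);
      wedge 5 6; - wedge 4 6; 0].

Definition eqs_6_158 : seq 'M[R]_6 :=
  [:: wedge 2 4 + wedge 3 5; 0; wedge 3 6; 0; - wedge 5 6; 0].

Definition eqs_6_164 : seq 'M[R]_6 :=
  [:: wedge 2 4 + wedge 3 5; a *: wedge 2 6; wedge 5 6;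
      - (a *: wedge 4 6); - wedge 3 6; 0].

Lemma eqs_4_6P : is_str_eqs eqs_4_6.
Proof. prove_str_eqs. Qed.
Lemma eqs_4_7P : is_str_eqs eqs_4_7.
Proof. prove_str_eqs. Qed.
Lemma eqs_5_16P : is_str_eqs eqs_5_16.
Proof. prove_str_eqs. Qed.
Lemma eqs_6_25P : is_str_eqs eqs_6_25.
Proof. prove_str_eqs. Qed.
Lemma eqs_6_51P : is_str_eqs eqs_6_51.
Proof. prove_str_eqs. Qed.
Lemma eqs_6_158P : is_str_eqs eqs_6_158.
Proof. prove_str_eqs. Qed.
Lemma eqs_6_164P : is_str_eqs eqs_6_164.
Proof. prove_str_eqs. Qed.

(* s_4_6_R2 stands for s_{4.6} (+) R^2, etc. *)
Definition s_4_6_R2 : lieAlgType R := lie_of eqs_4_6P.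
Definition s_4_7_R2 : lieAlgType R := lie_of eqs_4_7P.
Definition s_5_16_R : lieAlgType R := lie_of eqs_5_16P.
Definition s_6_25 : lieAlgType R := lie_of eqs_6_25P.
Definition s_6_51 : lieAlgType R := lie_of eqs_6_51P.
Definition s_6_158 : lieAlgType R := lie_of eqs_6_158P.
Definition s_6_164 : lieAlgType R := lie_of eqs_6_164P.

End Algebras.

Arguments s_4_6_R2 R : clear implicits.
Arguments s_4_7_R2 R : clear implicits.
Arguments s_5_16_R R : clear implicits.
Arguments s_6_25 R : clear implicits.
Arguments s_6_158 R : clear implicits.

(* Main.v *)
(* Write z for a generator of n^1; strong unimodularity makes z central in g, and
   J z lies in n. Completing z, J z to a basis z, J z, u, J u of n \cap J n and
   choosing Y in n outside of it, X = - J Y completes a basis of g, and the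
   integrability of J forces ad X to act on n with very few parameters (see
   eqs_gen). The Jacobi identity, the vanishing of the trace of ad X on n / n^1
   and the non-nilpotency of g leave two cases, according to whether the
   eigenvalue c of ad X on J z is zero. In both, an explicit rational change of
   basis decomposes n into eigenspaces and rotation planes of ad X, and rescaling
   gives one of the listed algebras.

   Conversely, in each of these algebras n is the span of f_1, ..., f_5: this
   ideal is nilpotent, and the whole algebra is not, since (ad f_6)^2 has a
   nonzero eigenvalue. *)
From HB Require Import structures.
Require Import Defs.
From mathcomp Require Import all_boot all_order all_algebra.
From mathcomp Require Import ring lra zify.
From mathcomp Require Import reals.

Set Implicit Arguments.
Unset Strict Implicit.
Unset Printing Implicit Defensive.

Import GRing.Theory Num.Theory.
Local Open Scope ring_scope.

(** * Frames: bases in which the bracket is given by 2-forms *)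

(** Integrability amounts to three equations. The Nijenhuis tensor N satisfies N(J x, y) = - J N(x,
    y), so it is determined by the pairs taken from the complex basis z, u, X. As z is central, N(x,
    z) = 0 reads [J x, J z] = J [x, J z]. On z, z', the plane of u and u', and Y, ad X then has
    eigenvalues 0, c, x + i y and x - i y, b. It is a derivation killing z, so two eigenvectors have
    a nonzero bracket in n^1 only if their eigenvalues add up to 0. With the trace condition c + 2 x
    + b = 0, either c is nonzero, b = - c and x = 0, or c = 0 and, n being neither abelian nor all
    of g, s and y are nonzero and x = b = 0. The practical obstacle is that brackets are matrices
    with up to fifteen symbolic parameters. Every basis change is therefore given with its inverse
    and read on coordinate functions that compute, which leaves only scalar identities. *)

Section StructureBracket.
Variables (R : fieldType) (phi : seq 'M[R]_6).
Implicit Types x y : 'rV[R]_6.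

HB.instance Definition _ x :=
  @GRing.isLinear.Build R 'rV[R]_6 'rV[R]_6 *:%R (str_bracket phi x)
    (str_bracket_linearr phi x).

Lemma str_bracket_suml (I : Type) (r : seq I) (F : I -> 'rV[R]_6) y :
  str_bracket phi (\sum_(i <- r) F i) y = \sum_(i <- r) str_bracket phi (F i) y.
Proof.
pose h := GRing.isLinear.Build R _ _ *:%R (str_bracket phi ^~ y)
  (str_bracket_linearl phi y).
pose f : {linear 'rV[R]_6 -> 'rV[R]_6} := HB.pack (str_bracket phi ^~ y) h.
exact: (linear_sum f).
Qed.

Lemma str_bracketZl a x y :
  str_bracket phi (a *: x) y = a *: str_bracket phi x y.
Proof.
have := str_bracket_linearl phi y a x 0; rewrite addr0 => ->.
by have := str_bracket_linearl phi y 1 0 0; rewrite scaler0 addr0 scale1r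
  -[X in X = _]addr0 => /addrI <-; rewrite addr0.
Qed.

End StructureBracket.

Section Bracket.
Variables (R : fieldType) (g : lieAlgType R).
Implicit Types x y : g.

Lemma bracketZl a x y : bracket (a *: x) y = a *: bracket x y.
Proof. by rewrite bracketC linearZ /= -scalerN -bracketC. Qed.

Lemma bracket_suml (I : Type) (r : seq I) (F : I -> g) y :
  bracket (\sum_(i <- r) F i) y = \sum_(i <- r) bracket (F i) y.
Proof.
rewrite bracketC linear_sum -sumrN.
by apply: eq_bigr => i _; rewrite -bracketC.
Qed.

End Bracket.

Section Frames.
Variables (R : fieldType) (g : lieAlgType R).
Implicit Types (e : 6.-tuple g) (x y : 'rV[R]_6) (phi psi : seq 'M[R]_6).

Definition comb e x : g := \sum_k x 0 k *: e`_k.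

Lemma comb_linear e : linear (comb e).
Proof.
move=> a x y; rewrite /comb scaler_sumr -big_split /=.
by apply: eq_bigr => k _; rewrite !mxE scalerDl scalerA.
Qed.

HB.instance Definition _ e :=
  @GRing.isLinear.Build R 'rV[R]_6 g *:%R (comb e) (comb_linear e).

Definition coords e (v : g) : 'rV[R]_6 := \row_k coord e k v.

Lemma coords_linear e : linear (coords e).
Proof. by move=> a v w; apply/rowP => k; rewrite !mxE linearP. Qed.

HB.instance Definition _ e :=
  @GRing.isLinear.Build R g 'rV[R]_6 *:%R (coords e) (coords_linear e).

Lemma comb_coords e v : basis_of fullv e -> comb e (coords e v) = v.
Proof.
move=> be; rewrite [RHS](coord_basis be (memvf v)).
by apply: eq_bigr => k _; rewrite mxE.
Qed.

Lemma coords_comb e x : basis_of fullv e -> coords e (comb e x) = x.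
Proof.
by move=> be; apply/rowP => k; rewrite mxE coord_sum_free // (basis_free be).
Qed.

Lemma dim_basis6 e : basis_of fullv e -> \dim {:g} = 6%N.
Proof. by move=> be; rewrite -(size_basis be). Qed.

Lemma comb_delta e k : comb e (delta_mx 0 k) = e`_k.
Proof.
rewrite /comb (bigD1 k) //= mxE !eqxx scale1r big1 ?addr0 // => i ik.
by rewrite mxE (negPf ik) scale0r.
Qed.

(** [phi] is not assumed to satisfy the Jacobi identity: a table with free parameters can thus be
    stated first, and its Jacobi relations deduced afterwards from those of [g]. *)
Definition frame e phi : Prop :=
  basis_of fullv e /\
  forall x y, bracket (comb e x) (comb e y) = comb e (str_bracket phi x y).

Lemma frame_table e phi : basis_of fullv e ->
  (forall x, str_bracket phi x x = 0) ->
  (forall i j : 'I_6, (i < j)%N ->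
     bracket e`_i e`_j =
     comb e (str_bracket phi (delta_mx 0 i) (delta_mx 0 j))) ->
  frame e phi.
Proof.
move=> be phixx tab; split=> // x y.
have phiC u v : str_bracket phi u v = - str_bracket phi v u.
  have := phixx (u + v); rewrite linearD /=.
  have := str_bracket_linearl phi u 1 u v; rewrite !scale1r => ->.
  have := str_bracket_linearl phi v 1 u v; rewrite !scale1r => ->.
  by rewrite !phixx add0r addr0 => /eqP; rewrite addrC addr_eq0 => /eqP.
have tab' (i j : 'I_6) : bracket e`_i e`_j =
    comb e (str_bracket phi (delta_mx 0 i) (delta_mx 0 j)).
  case: (ltngtP i j) => [ij|ji|/val_inj ->].
  - exact: tab.
  - by rewrite bracketC tab // phiC linearN opprK.
  - by rewrite bracketxx phixx linear0.
rewrite {1}/comb bracket_suml.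
rewrite [X in _ = comb _ (str_bracket _ X _)]row_sum_delta.
rewrite str_bracket_suml [RHS]linear_sum /=.
apply: eq_bigr => i _; rewrite bracketZl str_bracketZl [RHS]linearZ /=; congr (_ *: _).
rewrite /comb [LHS]linear_sum -/(comb _ _) /=.
rewrite [X in _ = comb _ (str_bracket _ _ X)]row_sum_delta.
rewrite [X in _ = comb _ X]linear_sum [RHS]linear_sum /=; apply: eq_bigr => j _.
by rewrite !linearZ /= tab'.
Qed.

Lemma frame_change e phi psi (r : 6.-tuple 'rV[R]_6) : frame e phi ->
  (forall x, str_bracket psi x x = 0) ->
  (forall x, \sum_k x 0 k *: r`_k = 0 -> x = 0) ->
  (forall i j : 'I_6, (i < j)%N ->
     str_bracket phi r`_i r`_j =
     \sum_k str_bracket psi (delta_mx 0 i) (delta_mx 0 j) 0 k *: r`_k) ->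
  exists e', frame e' psi.
Proof.
move=> [be br] psixx rfree tab; exists (map_tuple (comb e) r).
have nthr (i : 'I_6) : (map_tuple (comb e) r)`_i = comb e r`_i.
  by rewrite (nth_map 0) // size_tuple.
have combr x : comb (map_tuple (comb e) r) x = comb e (\sum_k x 0 k *: r`_k).
  by rewrite linear_sum; apply: eq_bigr => k _; rewrite nthr linearZ.
apply: frame_table => // [|i j ij]; last by rewrite !nthr br tab // combr.
rewrite basisEfree subvf size_tuple (dim_basis6 be) leqnn !andbT.
apply/freeP => x0 x0P i; pose x : 'rV[R]_6 := \row_k x0 k.
suff /rowP/(_ i) : x = 0 by rewrite !mxE.
apply: rfree; rewrite -[LHS](coords_comb _ be) -combr.
rewrite -[RHS](linear0 (coords e)) /=; congr (coords e _); rewrite -[RHS]x0P.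
by apply: eq_bigr => k _; rewrite mxE.
Qed.

End Frames.

Section FrameIso.
Variables (R : fieldType) (g : lieAlgType R).
Variables (phi : seq 'M[R]_6) (phiP : is_str_eqs phi).

Lemma frame_iso (e : 6.-tuple g) : frame e phi -> lie_isomorphic g (lie_of phiP).
Proof.
move=> [be br].
pose c : g -> lie_of phiP := coords e.
have lc : linear c by exact: coords_linear.
pose h := GRing.isLinear.Build R g (lie_of phiP) *:%R c lc.
pose cl : {linear g -> lie_of phiP} := HB.pack c h.
exists (linfun cl); split.
  by exists (comb e) => v; rewrite lfunE /=; [exact: comb_coords | exact: coords_comb].
move=> v w; rewrite !lfunE /=.
rewrite -{1}(comb_coords v be) -{1}(comb_coords w be) br.
exact: coords_comb.
Qed.

Lemma frame_of_bij (f : 'Hom(g, lie_of phiP)) (f' : lie_of phiP -> g) :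
  cancel f f' -> cancel f' f ->
  (forall x y, f (bracket x y) = bracket (f x) (f y)) ->
  exists e : 6.-tuple g, frame e phi /\ comb e =1 f'.
Proof.
move=> fK f'K fbr.
have lf' : linear f' by exact: (can2_linear fK f'K).
pose h := GRing.isLinear.Build R (lie_of phiP) g *:%R f' lf'.
pose l : {linear 'rV[R]_6 -> g} := HB.pack f' h.
exists [tuple l (delta_mx 0 k) | k < 6].
have ce x : comb [tuple l (delta_mx 0 k) | k < 6] x = l x.
  rewrite [in RHS](row_sum_delta x) linear_sum; apply: eq_bigr => k _.
  by rewrite -tnth_nth tnth_mktuple linearZ.
split; last exact: ce; split; last first.
  move=> x y; rewrite !ce /=; apply: (can_inj fK).
  by rewrite fbr !f'K.
rewrite basisEfree subvf; apply/andP; split; last first.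
  apply: leq_trans (dim_span _); apply/dimvS/subvP => v _.
  rewrite -(fK v) -[f' _]ce; apply: memv_suml => k _.
  by rewrite memvZ // memv_span // mem_nth // size_tuple.
apply/freeP => x0 x0P i; pose x : 'rV[R]_6 := \row_k x0 k.
suff /rowP/(_ i) : x = 0 by rewrite !mxE.
apply: (can_inj f'K); rewrite -[f' x]ce -[f' 0]/(l 0) linear0 -[RHS]x0P.
by apply: eq_bigr => k _; rewrite mxE.
Qed.

Lemma frame_of_iso :
  lie_isomorphic g (lie_of phiP) -> exists e : 6.-tuple g, frame e phi.
Proof.
by move=> [f [[f' fK f'K] /(frame_of_bij fK f'K)[e [fe _]]]]; exists e.
Qed.

End FrameIso.

Lemma std_frame (R : fieldType) (phi : seq 'M[R]_6) (phiP : is_str_eqs phi) :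
  exists e : 6.-tuple (lie_of phiP), frame e phi /\ comb e =1 id.
Proof.
by apply: (frame_of_bij (f := \1%VF)) => [x | x | x y]; rewrite !lfunE.
Qed.

Lemma forall_lt6 (P : nat -> Prop) :
  P 0%N -> P 1%N -> P 2%N -> P 3%N -> P 4%N -> P 5%N -> forall k, (k < 6)%N -> P k.
Proof. by move=> ? ? ? ? ? ?; do 6![case=> [_ //|]]. Qed.

Lemma forall_pairs6 (P : nat -> nat -> Prop) :
  P 0%N 1%N -> P 0%N 2%N -> P 0%N 3%N -> P 0%N 4%N -> P 0%N 5%N ->
  P 1%N 2%N -> P 1%N 3%N -> P 1%N 4%N -> P 1%N 5%N -> P 2%N 3%N ->
  P 2%N 4%N -> P 2%N 5%N -> P 3%N 4%N -> P 3%N 5%N -> P 4%N 5%N ->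
  forall i j, (i < j < 6)%N -> P i j.
Proof.
move=> ? ? ? ? ? ? ? ? ? ? ? ? ? ? ? i j /andP[ij j6]; move: j j6 i ij.
by apply: forall_lt6; case=> [|[|[|[|[|i]]]]].
Qed.

(** * Coordinate computations with 2-forms *)

Section Rows.
Variable R : fieldType.
Implicit Types (x y : 'rV[R]_6) (phi psi : seq 'M[R]_6).

Lemma f_E i k : (i < 6)%N -> (k < 6)%N ->
  (f_ i.+1 : 'rV[R]_6) 0 (inord k) = (k == i)%:R.
Proof. by move=> i6 k6; rewrite mxE eqxx -(inj_eq val_inj) /= !inordK. Qed.

Lemma big_ord6 (V : nmodType) (F : 'I_6 -> V) :
  \sum_k F k = F (inord 0) + F (inord 1) + F (inord 2) + F (inord 3)
               + F (inord 4) + F (inord 5).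
Proof.
rewrite !big_ord_recl big_ord0 addr0 !addrA.
by congr (F _ + F _ + F _ + F _ + F _ + F _);
  apply: val_inj; rewrite /= ?inordK.
Qed.

(* Forms given as matrices do not compute; B is a copy of phi, acting on
   coordinate functions, that does. *)
Definition evaluates phi (B : (nat -> R) -> (nat -> R) -> nat -> R) : Prop :=
  forall x y u v, (forall i, (i < 6)%N -> x 0 (inord i) = u i) ->
  (forall i, (i < 6)%N -> y 0 (inord i) = v i) ->
  forall k, (k < 6)%N -> form_eval phi`_k x y = B u v k.

(** The inverse matrix [r'] certifies that the new vectors are independent, so a change of basis
    reduces to finitely many scalar identities. The tests by [eqn] reduce by computation on
    numerals. *)
Lemma frame_change6 (g : lieAlgType R) (e : 6.-tuple g) phi psi B B'
    (r r' : nat -> nat -> R) :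
  evaluates phi B -> evaluates psi B' ->
  (forall x, str_bracket psi x x = 0) ->
  (forall i, (i < 6)%N -> forall j, (j < 6)%N ->
     r i 0%N * r' 0%N j + r i 1%N * r' 1%N j + r i 2%N * r' 2%N j
     + r i 3%N * r' 3%N j + r i 4%N * r' 4%N j + r i 5%N * r' 5%N j
     = if eqn i j then 1 else 0) ->
  (forall i j, (i < j < 6)%N -> forall k, (k < 6)%N ->
     B (r i) (r j) k =
     let c := B' (fun l => if eqn l i then 1 else 0)
                 (fun l => if eqn l j then 1 else 0) in
     c 0%N * r 0%N k + c 1%N * r 1%N k + c 2%N * r 2%N k
     + c 3%N * r 3%N k + c 4%N * r 4%N k + c 5%N * r 5%N k) ->
  frame e phi -> exists e' : 6.-tuple g, frame e' psi.
Proof.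
move=> BE B'E psixx inv tab fe.
pose rt := [tuple \row_(k < 6) r i k | i < 6].
have rtE (i : 'I_6) : rt`_i = \row_k r i k by rewrite -tnth_nth tnth_mktuple.
have fE (h : 'I_6) : delta_mx 0 h = f_ h.+1 :> 'rV[R]_6 by rewrite /f_ inord_val.
apply: (@frame_change _ _ e phi psi rt) => // [x | i j ij].
  move=> /rowP x0; pose y k := x 0 (inord k).
  apply: eq_row6 => j j6; rewrite row0E -/(y j).
  have xl l : (l < 6)%N -> y 0%N * r 0%N l + y 1%N * r 1%N l + y 2%N * r 2%N l
      + y 3%N * r 3%N l + y 4%N * r 4%N l + y 5%N * r 5%N l = 0.
    by move=> l6; have := x0 (inord l); rewrite mxE summxE big_ord6 !mxE !rtE
      !mxE !inordK.
  (* x = x (r r') = (x r) r' = 0: the entries of the identity matrix are replaced by those of r r',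
     and the sums are regrouped. *)
  have -> : y j = y 0%N * (if eqn 0%N j then 1 else 0)
      + y 1%N * (if eqn 1%N j then 1 else 0) + y 2%N * (if eqn 2%N j then 1 else 0)
      + y 3%N * (if eqn 3%N j then 1 else 0) + y 4%N * (if eqn 4%N j then 1 else 0)
      + y 5%N * (if eqn 5%N j then 1 else 0).
    by move: j j6; apply: forall_lt6 => /=; ring.
  rewrite -!inv //.
  transitivity (0 * r' 0%N j + 0 * r' 1%N j + 0 * r' 2%N j
      + 0 * r' 3%N j + 0 * r' 4%N j + 0 * r' 5%N j); last by ring.
  rewrite -{1}(xl 0%N) // -{1}(xl 1%N) // -{1}(xl 2%N) // -{1}(xl 3%N) //
    -{1}(xl 4%N) // -{1}(xl 5%N) //.
  ring.
have rE (h : 'I_6) k : (k < 6)%N -> (\row_(l < 6) r h l) 0 (inord k) = r h k.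
  by move=> k6; rewrite mxE inordK.
have dE (h : 'I_6) k : (k < 6)%N ->
  (f_ h.+1 : 'rV[R]_6) 0 (inord k) = if eqn k h then 1 else 0.
  by move=> k6; rewrite f_E // -[eqn k h]/(k == h :> nat); case: eqP.
apply: eq_row6 => k k6; rewrite str_bracketE // !rtE.
rewrite (BE _ _ _ _ (rE i) (rE j)) // tab ?ij //= summxE big_ord6.
rewrite !mxE !rtE !mxE !inordK // !fE !(B'E _ _ _ _ (dE i) (dE j)) //; ring.
Qed.

End Rows.

(* The bracket table, in a basis (z, z', u, u', Y, X), of the general
   semidirect product that arises below:
   [z', Y] = c z, [u, u'] = s z, [u, Y] = p z, [u', Y] = q z, [X, z'] = c z',
   [X, u] = x u + y u' + r z + t z', [X, u'] = x u' - y u + r' z + t' z',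
   [X, Y] = b Y + k u + l u' + m z + n z'. *)
Definition eqs_gen (R : fieldType) (c s p q x y r t r' t' b k l m n : R)
    : seq 'M[R]_6 :=
  [:: r *: wedge 3 6 + r' *: wedge 4 6 + m *: wedge 5 6
      - (c *: wedge 2 5 + s *: wedge 3 4 + p *: wedge 3 5 + q *: wedge 4 5);
      c *: wedge 2 6 + t *: wedge 3 6 + t' *: wedge 4 6 + n *: wedge 5 6;
      x *: wedge 3 6 - y *: wedge 4 6 + k *: wedge 5 6;
      y *: wedge 3 6 + x *: wedge 4 6 + l *: wedge 5 6;
      b *: wedge 5 6; 0].

Section Evaluators.
Variable R : fieldType.
Implicit Types (u v : nat -> R) (a : R).

Definition minor u v i j : R := u i.-1 * v j.-1 - u j.-1 * v i.-1.

Definition ev_gen (c s p q x y r t r' t' b k l m n : R) u v :=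
  nth 0 [:: r * minor u v 3 6 + r' * minor u v 4 6 + m * minor u v 5 6
            - (c * minor u v 2 5 + s * minor u v 3 4 + p * minor u v 3 5
               + q * minor u v 4 5);
            c * minor u v 2 6 + t * minor u v 3 6 + t' * minor u v 4 6
            + n * minor u v 5 6;
            x * minor u v 3 6 - y * minor u v 4 6 + k * minor u v 5 6;
            y * minor u v 3 6 + x * minor u v 4 6 + l * minor u v 5 6;
            b * minor u v 5 6; 0].

Definition ev_4_6 u v :=
  nth 0 [:: minor u v 2 3; minor u v 2 6; - minor u v 3 6; 0; 0; 0].

Definition ev_4_7 u v :=
  nth 0 [:: minor u v 2 3; minor u v 3 6; - minor u v 2 6; 0; 0; 0].

Definition ev_5_16 u v :=
  nth 0 [:: minor u v 2 3 + minor u v 4 6; minor u v 3 6; - minor u v 2 6; 0; 0; 0].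

Definition ev_6_25 u v :=
  nth 0 [:: minor u v 2 3; minor u v 3 6; - minor u v 2 6; 0; minor u v 4 6; 0].

Definition ev_6_51 a u v :=
  nth 0 [:: minor u v 2 3; a * minor u v 2 6; - (a * minor u v 3 6);
            minor u v 5 6; - minor u v 4 6; 0].

Definition ev_6_158 u v :=
  nth 0 [:: minor u v 2 4 + minor u v 3 5; 0; minor u v 3 6; 0; - minor u v 5 6; 0].

Definition ev_6_164 a u v :=
  nth 0 [:: minor u v 2 4 + minor u v 3 5; a * minor u v 2 6; minor u v 5 6;
            - (a * minor u v 4 6); - minor u v 3 6; 0].

End Evaluators.

Ltac unfold_ev :=
  rewrite /ev_gen /ev_4_6 /ev_4_7 /ev_5_16 /ev_6_25 /ev_6_51 /ev_6_158
    /ev_6_164 /minor /=.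

Ltac prove_evaluates :=
  let xu := fresh in let yv := fresh in
  move=> ? ? ? ? xu yv; apply: forall_lt6; unfold_ev;
    rewrite ?(form_evalD, form_evalN, form_evalZ, form_eval0, wedgeE) /= ?xu ?yv //;
  ring.

Section Evaluation.
Variable R : fieldType.

Lemma eqs_genE (c s p q x y r t r' t' b k l m n : R) :
  evaluates (eqs_gen c s p q x y r t r' t' b k l m n)
    (ev_gen c s p q x y r t r' t' b k l m n).
Proof. prove_evaluates. Qed.

Lemma eqs_4_6E : evaluates (eqs_4_6 R) (@ev_4_6 R).
Proof. prove_evaluates. Qed.

Lemma eqs_4_7E : evaluates (eqs_4_7 R) (@ev_4_7 R).
Proof. prove_evaluates. Qed.

Lemma eqs_5_16E : evaluates (eqs_5_16 R) (@ev_5_16 R).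
Proof. prove_evaluates. Qed.

Lemma eqs_6_25E : evaluates (eqs_6_25 R) (@ev_6_25 R).
Proof. prove_evaluates. Qed.

Lemma eqs_6_51E (a : R) : evaluates (eqs_6_51 a) (ev_6_51 a).
Proof. prove_evaluates. Qed.

Lemma eqs_6_158E : evaluates (eqs_6_158 R) (@ev_6_158 R).
Proof. prove_evaluates. Qed.

Lemma eqs_6_164E (a : R) : evaluates (eqs_6_164 a) (ev_6_164 a).
Proof. prove_evaluates. Qed.

Lemma eqs_genxx (c s p q x y r t r' t' b k l m n : R) v :
  str_bracket (eqs_gen c s p q x y r t r' t' b k l m n) v v = 0.
Proof.
apply: eq_row6 => i i6; rewrite str_bracketE // row0E.
rewrite (eqs_genE _ _ _ _ _ _ _ _ _ _ _ _ _ _ _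
           (fun _ _ => erefl) (fun _ _ => erefl)) //.
move: i i6; apply: forall_lt6; unfold_ev; ring.
Qed.

End Evaluation.

(** * Changes of frame *)

Definition entries (R : fieldType) (r : seq (seq R)) (i k : nat) : R :=
  nth 0 (nth [::] r i) k.

Ltac solve_evaluates :=
  lazymatch goal with
  | |- evaluates (eqs_4_6 _) _ => exact: eqs_4_6E
  | |- evaluates (eqs_4_7 _) _ => exact: eqs_4_7E
  | |- evaluates (eqs_5_16 _) _ => exact: eqs_5_16E
  | |- evaluates (eqs_6_25 _) _ => exact: eqs_6_25E
  | |- evaluates (eqs_6_51 _) _ => exact: eqs_6_51E
  | |- evaluates (eqs_6_158 _) _ => exact: eqs_6_158E
  | |- evaluates (eqs_6_164 _) _ => exact: eqs_6_164E
  | _ => exact: eqs_genE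
  end.

Ltac solve_alternating :=
  lazymatch goal with
  | |- context [eqs_4_6] => exact (proj1 (eqs_4_6P _))
  | |- context [eqs_4_7] => exact (proj1 (eqs_4_7P _))
  | |- context [eqs_5_16] => exact (proj1 (eqs_5_16P _))
  | |- context [eqs_6_25] => exact (proj1 (eqs_6_25P _))
  | |- context [eqs_6_51] => exact (proj1 (eqs_6_51P _))
  | |- context [eqs_6_158] => exact (proj1 (eqs_6_158P _))
  | |- context [eqs_6_164] => exact (proj1 (eqs_6_164P _))
  | _ => exact: eqs_genxx
  end.

(* The rows of r are the new basis in the old one; r' is the inverse matrix. *)
Ltac frame_change_with r r' :=
  eapply (@frame_change6 _ _ _ _ _ _ _ (entries r) (entries r'));
  [solve_evaluates | solve_evaluates | solve_alternating
  | apply: forall_lt6; apply: forall_lt6 | apply: forall_pairs6; apply: forall_lt6];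
  cbv beta match fix zeta delta [entries minor nth eqn Nat.pred ev_gen ev_4_6
    ev_4_7 ev_5_16 ev_6_25 ev_6_51 ev_6_158 ev_6_164].

Section Reduction.
Variables (R : fieldType) (g : lieAlgType R) (e : 6.-tuple g).
Implicit Types c s p q y r t k l m n : R.

(* The new basis is z, z', u - r' z - t' z', u' + r z + t z', Y + A u + D u', X:
   a rotation plane for ad X and a vector commuting with it. *)
Lemma reduce_c0 s p q y r t r' t' k l m n A D :
  p = - (D * s) -> q = A * s -> k = D * y -> l = - (A * y) ->
  frame e (eqs_gen 0 s p q 0 y (y * r) (y * t) (y * r') (y * t') 0 k l m n) ->
  exists e' : 6.-tuple g,
    frame e' (eqs_gen 0 s 0 0 0 y 0 0 0 0 0 0 0 (m + A * (y * r) + D * (y * r'))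
                (n + A * (y * t) + D * (y * t'))).
Proof.
move=> -> -> -> ->.
frame_change_with
 [:: [:: 1]; [:: 0; 1]; [:: - r'; - t'; 1];
   [:: r; t; 0; 1]; [:: 0; 0; A; D; 1]; [:: 0; 0; 0; 0; 0; 1]]
 [:: [:: 1]; [:: 0; 1]; [:: r'; t'; 1]; [:: - r; - t; 0; 1];
   [:: - (A * r') + D * r; - (A * t') + D * t; - A; - D; 1]; [:: 0; 0; 0; 0; 0; 1]].
all: ring.
Qed.

(* The new basis is z, z', u + F z', u' + F' z', Y + A u + D u' + E z + G z', X:
   a rotation plane for ad X modulo z, and an eigenvector for -c. *)
Lemma reduce_c s c p q y r t r' t' k l m n A D E F F' G :
  p = - (D * s) - F * c -> q = A * s - F' * c ->
  t = y * F' - c * F -> t' = - (y * F) - c * F' ->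
  k = y * D - c * A -> l = - (y * A) - c * D ->
  m = - (A * r) - D * r' - c * E -> n = - (A * t) - D * t' - 2 * c * G ->
  frame e (eqs_gen c s p q 0 y r t r' t' (- c) k l m n) ->
  exists e' : 6.-tuple g,
    frame e' (eqs_gen c s 0 0 0 y r 0 r' 0 (- c) 0 0 0 0).
Proof.
move=> -> -> -> -> -> -> -> ->.
frame_change_with
 [:: [:: 1]; [:: 0; 1]; [:: 0; F; 1];
   [:: 0; F'; 0; 1]; [:: E; G; A; D; 1]; [:: 0; 0; 0; 0; 0; 1]]
 [:: [:: 1]; [:: 0; 1]; [:: 0; - F; 1]; [:: 0; - F'; 0; 1];
   [:: - E; A * F + D * F' - G; - A; - D; 1]; [:: 0; 0; 0; 0; 0; 1]].
all: ring.
Qed.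

(* Removes the components on z left in ad X, by a change of u and u' if y <> 0,
   and by adding to X an element of the Heisenberg algebra <u, u', z> if s <> 0. *)
Lemma reduce_z s c y r r' A D G H :
  r = y * D + H * s -> r' = - (y * A) - G * s ->
  frame e (eqs_gen c s 0 0 0 y r 0 r' 0 (- c) 0 0 0 0) ->
  exists e' : 6.-tuple g,
    frame e' (eqs_gen c s 0 0 0 y 0 0 0 0 (- c) 0 0 0 0).
Proof.
move=> -> ->.
frame_change_with
 [:: [:: 1]; [:: 0; 1]; [:: A; 0; 1]; [:: D; 0; 0; 1]; [:: 0; 0; 0; 0; 1];
   [:: 0; 0; G; H; 0; 1]]
 [:: [:: 1]; [:: 0; 1]; [:: - A; 0; 1]; [:: - D; 0; 0; 1]; [:: 0; 0; 0; 0; 1];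
   [:: G * A + H * D; 0; - G; - H; 0; 1]].
all: ring.
Qed.

Lemma frame_4_7 s y : s != 0 -> y != 0 ->
  frame e (eqs_gen 0 s 0 0 0 y 0 0 0 0 0 0 0 0 0) ->
  exists e' : 6.-tuple g, frame e' (eqs_4_7 R).
Proof.
move=> s0 y0.
frame_change_with
 [:: [:: - s]; [:: 0; 0; 1]; [:: 0; 0; 0; 1]; [:: 0; 0; 0; 0; 1]; [:: 0; 1];
   [:: 0; 0; 0; 0; 0; - y^-1]]
 [:: [:: - s^-1]; [:: 0; 0; 0; 0; 1]; [:: 0; 1]; [:: 0; 0; 1]; [:: 0; 0; 0; 1];
   [:: 0; 0; 0; 0; 0; - y]].
all: by field; rewrite ?s0 ?y0.
Qed.

Lemma frame_5_16 s y m : s != 0 -> y != 0 -> m != 0 ->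
  frame e (eqs_gen 0 s 0 0 0 y 0 0 0 0 0 0 0 m 0) ->
  exists e' : 6.-tuple g, frame e' (eqs_5_16 R).
Proof.
move=> s0 y0 m0.
frame_change_with
 [:: [:: - s]; [:: 0; 0; 1]; [:: 0; 0; 0; 1]; [:: 0; 0; 0; 0; s * y / m];
   [:: 0; 1]; [:: 0; 0; 0; 0; 0; - y^-1]]
 [:: [:: - s^-1]; [:: 0; 0; 0; 0; 1]; [:: 0; 1]; [:: 0; 0; 1];
   [:: 0; 0; 0; m / (s * y)]; [:: 0; 0; 0; 0; 0; - y]].
all: by field; rewrite ?s0 ?y0 ?m0.
Qed.

(** As [n] is nonzero, [X, Y] = m z + n z' is independent of z; a multiple of it is taken as f_5 in
    place of z', which absorbs [m]. *)
Lemma frame_6_25 s y m n : s != 0 -> y != 0 -> n != 0 ->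
  frame e (eqs_gen 0 s 0 0 0 y 0 0 0 0 0 0 0 m n) ->
  exists e' : 6.-tuple g, frame e' (eqs_6_25 R).
Proof.
move=> s0 y0 n0.
frame_change_with
 [:: [:: - s]; [:: 0; 0; 1]; [:: 0; 0; 0; 1]; [:: 0; 0; 0; 0; 1];
   [:: - m / y; - n / y]; [:: 0; 0; 0; 0; 0; - y^-1]]
 [:: [:: - s^-1]; [:: m / (n * s); 0; 0; 0; - y / n]; [:: 0; 1]; [:: 0; 0; 1];
   [:: 0; 0; 0; 1]; [:: 0; 0; 0; 0; 0; - y]].
all: by field; rewrite ?s0 ?y0 ?n0.
Qed.

Lemma frame_4_6 c : c != 0 ->
  frame e (eqs_gen c 0 0 0 0 0 0 0 0 0 (- c) 0 0 0 0) ->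
  exists e' : 6.-tuple g, frame e' (eqs_4_6 R).
Proof.
move=> c0.
frame_change_with
 [:: [:: - c]; [:: 0; 1]; [:: 0; 0; 0; 0; 1]; [:: 0; 0; 1]; [:: 0; 0; 0; 1];
   [:: 0; 0; 0; 0; 0; c^-1]]
 [:: [:: - c^-1]; [:: 0; 1]; [:: 0; 0; 0; 1]; [:: 0; 0; 0; 0; 1]; [:: 0; 0; 1];
   [:: 0; 0; 0; 0; 0; c]].
all: by field; rewrite ?c0.
Qed.

Lemma frame_6_158 c s : c != 0 -> s != 0 ->
  frame e (eqs_gen c s 0 0 0 0 0 0 0 0 (- c) 0 0 0 0) ->
  exists e' : 6.-tuple g, frame e' (eqs_6_158 R).
Proof.
move=> c0 s0.
frame_change_with
 [:: [:: - s]; [:: 0; 0; 1]; [:: 0; 1]; [:: 0; 0; 0; 1];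
   [:: 0; 0; 0; 0; s / c]; [:: 0; 0; 0; 0; 0; c^-1]]
 [:: [:: - s^-1]; [:: 0; 0; 1]; [:: 0; 1]; [:: 0; 0; 0; 1];
   [:: 0; 0; 0; 0; c / s]; [:: 0; 0; 0; 0; 0; c]].
all: by field; rewrite ?c0 ?s0.
Qed.

(** Dividing X by - y normalises the rotation. The eigenvectors z' and Y, with opposite eigenvalues,
    can serve as f_2 and f_3 in either order; exchanging them changes the sign of the parameter, so
    it can be made positive. *)
Lemma frame_6_51_pos c y : c != 0 -> y != 0 ->
  frame e (eqs_gen c 0 0 0 0 y 0 0 0 0 (- c) 0 0 0 0) ->
  exists e' : 6.-tuple g, frame e' (eqs_6_51 (c / y)).
Proof.
move=> c0 y0.
frame_change_with
 [:: [:: c]; [:: 0; 0; 0; 0; 1]; [:: 0; 1]; [:: 0; 0; 1]; [:: 0; 0; 0; 1];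
   [:: 0; 0; 0; 0; 0; - y^-1]]
 [:: [:: c^-1]; [:: 0; 0; 1]; [:: 0; 0; 0; 1]; [:: 0; 0; 0; 0; 1]; [:: 0; 1];
   [:: 0; 0; 0; 0; 0; - y]].
all: by field; rewrite ?c0 ?y0.
Qed.

Lemma frame_6_51_neg c y : c != 0 -> y != 0 ->
  frame e (eqs_gen c 0 0 0 0 y 0 0 0 0 (- c) 0 0 0 0) ->
  exists e' : 6.-tuple g, frame e' (eqs_6_51 (- (c / y))).
Proof.
move=> c0 y0.
frame_change_with
 [:: [:: - c]; [:: 0; 1]; [:: 0; 0; 0; 0; 1]; [:: 0; 0; 1]; [:: 0; 0; 0; 1];
   [:: 0; 0; 0; 0; 0; - y^-1]]
 [:: [:: - c^-1]; [:: 0; 1]; [:: 0; 0; 0; 1]; [:: 0; 0; 0; 0; 1]; [:: 0; 0; 1];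
   [:: 0; 0; 0; 0; 0; - y]].
all: by field; rewrite ?c0 ?y0.
Qed.

Lemma frame_6_164_pos c s y : c != 0 -> s != 0 -> y != 0 ->
  frame e (eqs_gen c s 0 0 0 y 0 0 0 0 (- c) 0 0 0 0) ->
  exists e' : 6.-tuple g, frame e' (eqs_6_164 (c / y)).
Proof.
move=> c0 s0 y0.
frame_change_with
 [:: [:: - s]; [:: 0; 0; 0; 0; - s / c]; [:: 0; 0; 1]; [:: 0; 1];
   [:: 0; 0; 0; 1]; [:: 0; 0; 0; 0; 0; - y^-1]]
 [:: [:: - s^-1]; [:: 0; 0; 0; 1]; [:: 0; 0; 1]; [:: 0; 0; 0; 0; 1];
   [:: 0; - c / s]; [:: 0; 0; 0; 0; 0; - y]].
all: by field; rewrite ?c0 ?s0 ?y0.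
Qed.

Lemma frame_6_164_neg c s y : c != 0 -> s != 0 -> y != 0 ->
  frame e (eqs_gen c s 0 0 0 y 0 0 0 0 (- c) 0 0 0 0) ->
  exists e' : 6.-tuple g, frame e' (eqs_6_164 (- (c / y))).
Proof.
move=> c0 s0 y0.
frame_change_with
 [:: [:: - s]; [:: 0; 1]; [:: 0; 0; 1]; [:: 0; 0; 0; 0; s / c];
   [:: 0; 0; 0; 1]; [:: 0; 0; 0; 0; 0; - y^-1]]
 [:: [:: - s^-1]; [:: 0; 1]; [:: 0; 0; 1]; [:: 0; 0; 0; 0; 1];
   [:: 0; 0; 0; c / s]; [:: 0; 0; 0; 0; 0; - y]].
all: by field; rewrite ?c0 ?s0 ?y0.
Qed.

End Reduction.

(** * The classification in terms of the parameters *)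

Definition framed (R : fieldType) (g : lieAlgType R) (phi : seq 'M[R]_6) : Prop :=
  exists e : 6.-tuple g, frame e phi.

Section Classification.
Variables (R : realFieldType) (g : lieAlgType R).

Definition listed : Prop :=
  framed g (eqs_4_6 R) \/ framed g (eqs_4_7 R) \/ framed g (eqs_5_16 R) \/
  framed g (eqs_6_25 R) \/ (exists a : R, 0 < a /\ framed g (eqs_6_51 a)) \/
  framed g (eqs_6_158 R) \/ (exists a : R, 0 < a /\ framed g (eqs_6_164 a)).

Lemma sqrD_eq0 (a b : R) : a ^+ 2 + b ^+ 2 = 0 -> a = 0 /\ b = 0.
Proof.
move=> /eqP; rewrite paddr_eq0 ?sqr_ge0 // !sqrf_eq0 => /andP[].
by move=> /eqP -> /eqP ->.
Qed.

(** The values of [k] and [l] are those imposed by the Jacobi identity. After reduction [X, Y] = M z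
    + N z', and the three algebras correspond to this vector lying outside n^1, being zero, or being
    nonzero in n^1. *)
Lemma listed_c0 (e : 6.-tuple g) s p q y r t m n : s != 0 -> y != 0 ->
  let k := - (y * p) / s in let l := - (y * q) / s in
  frame e (eqs_gen 0 s p q 0 y r t (p - t) (r + q) 0 k l m n) ->
  listed.
Proof.
move=> s0 y0 k l fe.
have [e' fe'] : framed g (eqs_gen 0 s 0 0 0 y 0 0 0 0 0 0 0
    (m + q / s * (y * (r / y)) + (- p / s) * (y * ((p - t) / y)))
    (n + q / s * (y * (t / y)) + (- p / s) * (y * ((r + q) / y)))).
  apply: (@reduce_c0 _ g e s p q y (r / y) (t / y) ((p - t) / y) ((r + q) / y) k l).
  1-4: by rewrite ?/k ?/l; field.
  by rewrite !(mulrC y (_ / y)) !divfK.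
move: fe'; set M := m + _ + _; set N := n + _ + _ => fe'.
have [N0|N0] := eqVneq N 0; last first.
  by do 3!right; left; apply: frame_6_25 fe'.
have [M0|M0] := eqVneq M 0; rewrite N0 ?M0 in fe'.
  by right; left; apply: frame_4_7 fe'.
by do 2!right; left; apply: frame_5_16 fe'.
Qed.

(** [s] decides whether the nilradical is h_5 or h_3 + R^2, and [y] whether ad X rotates the plane
    of u and u'. *)
Lemma listed_normal (e : 6.-tuple g) c s y : c != 0 ->
  frame e (eqs_gen c s 0 0 0 y 0 0 0 0 (- c) 0 0 0 0) -> listed.
Proof.
move=> c0 fe; have [y0|y0] := eqVneq y 0.
  have [s0|s0] := eqVneq s 0; rewrite y0 ?s0 in fe.
    by left; apply: frame_4_6 fe.
  by do 5!right; left; apply: frame_6_158 fe.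
have cy0 : c / y != 0 by rewrite mulf_neq0 ?invr_eq0.
have [s0|s0] := eqVneq s 0.
  rewrite s0 in fe; do 4!right; left; have [cy|cy|cy] := ltrgtP 0 (c / y).
  - by exists (c / y); split=> //; apply: frame_6_51_pos fe.
  - by exists (- (c / y)); rewrite oppr_gt0; split=> //; apply: frame_6_51_neg fe.
  - by rewrite -cy eqxx in cy0.
do 6!right; have [cy|cy|cy] := ltrgtP 0 (c / y).
- by exists (c / y); split=> //; apply: frame_6_164_pos fe.
- by exists (- (c / y)); rewrite oppr_gt0; split=> //; apply: frame_6_164_neg fe.
- by rewrite -cy eqxx in cy0.
Qed.

(** [t] and [r] are the values imposed by the Jacobi identity. Once u, u' and Y are corrected, the
    brackets of the plane with Y vanish by themselves: they would have eigenvalues - c + i y and - c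
    - i y, whereas z has eigenvalue 0. *)
Lemma listed_c (e : 6.-tuple g) c s p q y k l m n : c != 0 ->
  let t := p - (y * q + l * s) / c in let r := (y * p + k * s) / c in
  frame e (eqs_gen c s p q 0 y r t (p - t) (r + q) (- c) k l m n) ->
  listed.
Proof.
move=> c0 t r fe; pose D := c ^+ 2 + y ^+ 2.
have D0 : c ^+ 2 + y ^+ 2 != 0.
  by apply/eqP => /sqrD_eq0[c0' _]; rewrite c0' eqxx in c0.
(* ad X has eigenvalues i y and - i y on the plane, never c or - c: [A], [B] and [F], [F'] solve 2 x
   2 systems of determinant c^2 + y^2. [E] and [G] divide by the gaps between the eigenvalue - c of
   Y and those of z and z', namely c and 2 c. *)
pose A := - (c * k + y * l) / D.
pose B := (y * k - c * l) / D.
pose F := - (y * (r + q) + c * t) / D.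
pose F' := (y * t - c * (r + q)) / D.
pose E := - (m + A * r + B * (p - t)) / c.
pose G := - (n + A * t + B * (r + q)) / (2 * c).
have [e' fe'] : framed g (eqs_gen c s 0 0 0 y r 0 (p - t) 0 (- c) 0 0 0 0).
  apply: (reduce_c (A := A) (D := B) (E := E) (F := F) (F' := F') (G := G)) fe.
  1-8: by rewrite ?/E ?/G ?/A ?/B ?/F ?/F' ?/D ?/t ?/r; field; rewrite ?D0 ?c0.
suff [e'' fe''] : framed g (eqs_gen c s 0 0 0 y 0 0 0 0 (- c) 0 0 0 0).
  exact: listed_normal fe''.
have [y0|y0] := eqVneq y 0; last first.
  apply: (reduce_z (A := - (p - t) / y) (D := r / y) (G := 0) (H := 0)) fe'.
  1-2: by field.
(* With y = s = 0 no basis change can remove the z-components of ad X on the plane. They vanish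
   because the relations r' = p - t and t' = r + q, due to J, combine with the Jacobi identity. *)
have [s0|s0] := eqVneq s 0.
  exists e'; move: fe'; rewrite /r /t y0 s0.
  by rewrite !(mul0r, mulr0, addr0, add0r, subr0, subrr).
apply: (reduce_z (A := 0) (D := 0) (G := - (p - t) / s) (H := r / s)) fe'.
all: by field.
Qed.

(** The first four equations come from the Jacobi identity and the fifth is the trace on n / n^1.
    The two negations say that g is not nilpotent and that n is not abelian. *)
Lemma listed_gen (e : 6.-tuple g) c s p q x y r t b k l m n :
  c * (c + b) = 0 -> x * s = 0 ->
  x * p + y * q + t * c + b * p + l * s = 0 ->
  x * q - y * p + (r + q) * c + b * q - k * s = 0 ->
  c + 2 * x + b = 0 ->
  ~ [/\ c = 0, b = 0, x = 0 & y = 0] ->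
  ~ [/\ c = 0, s = 0, p = 0 & q = 0] ->
  frame e (eqs_gen c s p q x y r t (p - t) (r + q) b k l m n) ->
  listed.
Proof.
move=> E1 E2 E3 E4 E5 N1 N2 fe.
have [c0|c0] := eqVneq c 0; last first.
  have bc : b = - c.
    by move/eqP: E1; rewrite mulf_eq0 (negPf c0) /= addrC addr_eq0 => /eqP.
  have x0 : x = 0 by move: E5; rewrite bc; lra.
  rewrite x0 bc in E3 E4 fe.
  apply: (@listed_c e c s p q y k l m n) => //.
  have -> : (y * p + k * s) / c = r.
    by apply: (mulIf c0); rewrite divfK //; lra.
  have -> : p - (y * q + l * s) / c = t.
    by apply: (mulIf c0); rewrite mulrBl divfK //; lra.
  exact: fe.
have bx : b = - (2 * x) by move: E5; rewrite c0; lra.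
(* If c = s = 0, the Jacobi relations are a linear system in [p] and [q] of determinant x^2 + y^2,
   nonzero by [N1]. Cramer's rule gives p = q = 0, against [N2]. *)
have [s0|s0] := eqVneq s 0.
  have xy0 : x ^+ 2 + y ^+ 2 != 0.
    by apply/eqP => /sqrD_eq0[x0 y0]; case: N1; rewrite bx x0 mulr0 oppr0.
  rewrite c0 s0 bx in E3 E4; case: N2; split=> //; apply: (mulfI xy0); rewrite mulr0.
    transitivity (- x * (x * p + y * q + t * 0 + - (2 * x) * p + l * 0)
      - y * (x * q - y * p + (r + q) * 0 + - (2 * x) * q - k * 0)); first by ring.
    by rewrite E3 E4 !mulr0 subrr.
  transitivity (y * (x * p + y * q + t * 0 + - (2 * x) * p + l * 0)
      - x * (x * q - y * p + (r + q) * 0 + - (2 * x) * q - k * 0)); first by ring.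
  by rewrite E3 E4 !mulr0 subrr.
have x0 : x = 0 by move/eqP: E2; rewrite mulf_eq0 (negPf s0) orbF => /eqP.
have b0 : b = 0 by rewrite bx x0 mulr0 oppr0.
have y0 : y != 0 by apply/eqP => y0; case: N1.
rewrite c0 x0 b0 in E3 E4 fe.
apply: (@listed_c0 e s p q y r t m n) => //.
have -> : - (y * p) / s = k by apply: (mulIf s0); rewrite divfK //; lra.
have -> : - (y * q) / s = l by apply: (mulIf s0); rewrite divfK //; lra.
exact: fe.
Qed.

End Classification.

(** * Jacobi relations of a bracket table *)

Section MoreFrames.
Variables (R : fieldType) (g : lieAlgType R) (e : 6.-tuple g).
Variables (phi : seq 'M[R]_6) (B : (nat -> R) -> (nat -> R) -> nat -> R).
Hypothesis phiE : evaluates phi B.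

Let row_of (u : nat -> R) : 'rV[R]_6 := \row_k u k.

Let row_ofE u k : (k < 6)%N -> row_of u 0 (inord k) = u k.
Proof. by move=> k6; rewrite mxE inordK. Qed.

Lemma str_bracket_ev (x y : 'rV[R]_6) u v : (forall i, (i < 6)%N -> x 0 (inord i) = u i) ->
  (forall i, (i < 6)%N -> y 0 (inord i) = v i) ->
  forall k, (k < 6)%N -> str_bracket phi x y 0 (inord k) = - B u v k.
Proof. by move=> xu yv k k6; rewrite str_bracketE // (phiE xu yv). Qed.

Lemma frame_jacobi u v w k : frame e phi -> (k < 6)%N ->
  B u (fun i => - B v w i) k + B v (fun i => - B w u i) k
  + B w (fun i => - B u v i) k = 0.
Proof.
move=> [be br] k6.
have := bracket_jacobi (comb e (row_of u)) (comb e (row_of v)) (comb e (row_of w)).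
rewrite !br -!linearD /= -[RHS](linear0 (comb e)) => /(congr1 (coords e)).
rewrite !coords_comb // => /rowP/(_ (inord k)); rewrite !rowDE row0E.
have S s t := str_bracket_ev (row_ofE s) (row_ofE t).
rewrite !(str_bracket_ev (row_ofE _) (S _ _)) // -!opprD => /eqP.
by rewrite oppr_eq0 => /eqP.
Qed.

Lemma frame_of_table (T : nat -> nat -> nat -> R) : basis_of fullv e ->
  (forall x, str_bracket phi x x = 0) ->
  (forall i j, (i < j < 6)%N -> forall k, (k < 6)%N ->
     T i j k = - B (fun l => if eqn l i then 1 else 0)
                   (fun l => if eqn l j then 1 else 0) k) ->
  (forall i j, (i < j < 6)%N -> bracket e`_i e`_j =
     T i j 0%N *: e`_0 + T i j 1%N *: e`_1 + T i j 2%N *: e`_2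
     + T i j 3%N *: e`_3 + T i j 4%N *: e`_4 + T i j 5%N *: e`_5) ->
  frame e phi.
Proof.
move=> be phixx TB tab; apply: frame_table => // i j ij.
rewrite tab ?ij //= /comb big_ord6 !inordK //.
have dE (h : 'I_6) k : (k < 6)%N ->
  (delta_mx 0 h : 'rV[R]_6) 0 (inord k) = if eqn k h then 1 else 0.
  move=> k6; have -> : delta_mx 0 h = f_ h.+1 :> 'rV[R]_6 by rewrite /f_ inord_val.
  by rewrite f_E // -[eqn k h]/(k == h :> nat); case: eqP.
by rewrite !TB ?ij ?ltn_ord // -!(str_bracket_ev (dE i) (dE j)).
Qed.

End MoreFrames.

Section GenJacobi.
Variables (R : fieldType) (g : lieAlgType R) (e : 6.-tuple g).
Variables c s p q x y r t r' t' b k l m n : R.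

(** These are the z-components of the Jacobi identity on (X, z', Y), (X, u, u'), (X, u, Y) and (X,
    u', Y). The factor 2 in the second is the trace 2 x of ad X on the plane of u and u'. *)
Lemma eqs_gen_jacobi :
  frame e (eqs_gen c s p q x y r t r' t' b k l m n) ->
  [/\ c * (c + b) = 0, 2 * (x * s) = 0,
      x * p + y * q + t * c + b * p + l * s = 0 &
      x * q - y * p + t' * c + b * q - k * s = 0].
Proof.
pose d i l : R := if eqn l i then 1 else 0.
move=> fe; have jac i j :=
  frame_jacobi (@eqs_genE R c s p q x y r t r' t' b k l m n) (d 5%N) (d i) (d j)
    fe (isT : (0 < 6)%N).
have E1 := jac 1%N 4%N; have E2 := jac 2%N 3%N.
have E3 := jac 2%N 4%N; have E4 := jac 3%N 4%N.
split; [rewrite -[RHS]E1 | rewrite -[RHS]E2 | rewrite -[RHS]E3 | rewrite -[RHS]E4];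
  cbv beta match fix zeta delta [d minor nth eqn Nat.pred ev_gen]; ring.
Qed.

End GenJacobi.

(** * Traces on quotients *)

Section QuotientTrace.
Variables (R : fieldType) (g : lieAlgType R).

(** This replaces the chosen basis of a complement by an adapted family. Expanding each family in
    the other modulo [W] turns both traces into the same double sum, as in tr(P Q) = tr(Q P). *)
Lemma quotient_traceE (f : {linear g -> g}) (U W : {vspace g}) m
    (b : 'I_m -> g) (phi : 'I_m -> {linear g -> R^o}) :
  (W <= U)%VS -> (forall v, v \in U -> f v \in U) ->
  (forall v, v \in W -> f v \in W) -> (forall i, b i \in U) ->
  (forall i v, v \in W -> phi i v = 0) ->
  (forall v, v \in U -> v - \sum_i (phi i v : R) *: b i \in W) ->
  quotient_trace f U W = \sum_i phi i (f (b i)).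
Proof.
move=> WU fU fW bU phiW Udec.
rewrite /quotient_trace /mxtrace.
set b0 := vbasis (U :\: W); set bw := cat_tuple b0 (vbasis W).
have bwU : basis_of U bw.
  have -> : basis_of U bw = basis_of ((U :\: W) + W)%VS bw.
    by rewrite addv_diff (addv_idPl WU).
  apply: cat_basis; try exact: vbasisP.
  by apply/directv_addP; exact: capv_diff.
pose phi0 j : {linear g -> R^o} := coord bw (lshift (\dim W) j).
have b0U j : b0`_j \in U.
  case: (ltnP j (\dim (U :\: W))) => [jU|jU]; last first.
    by rewrite nth_default ?mem0v // size_tuple.
  by rewrite (subvP (diffvSl U W)) // vbasis_mem // mem_nth // size_tuple.
have dec0 v : v \in U -> v - \sum_j (phi0 j v : R) *: b0`_j \in W.
  move=> vU; rewrite [v in v - _](coord_basis bwU vU) big_split_ord /=.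
  rewrite [X in X + _ - _](eq_bigr (fun j => (phi0 j v : R) *: b0`_j)); last first.
    by move=> j _; rewrite nth_cat size_tuple ltn_ord.
  rewrite addrC addKr; apply: memv_suml => j _; rewrite memvZ // nth_cat size_tuple.
  by rewrite ltnNge leq_addr /= addKn vbasis_mem // mem_nth // size_tuple.
have phi0W j v : v \in W -> phi0 j v = 0.
  move=> vW; rewrite (coord_vbasis vW) linear_sum big1 // => i _.
  rewrite linearZ /= /phi0.
  have -> : (vbasis W)`_i = bw`_(rshift (\dim (U :\: W)) i).
    by rewrite nth_cat size_tuple /= ltnNge leq_addr /= addKn.
  by rewrite coord_free ?(basis_free bwU) // eq_rlshift scaler0.
transitivity (\sum_j phi0 j (f b0`_j)).
  by apply: eq_bigr => j _; rewrite mxE (tnth_nth 0).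
have congW (psi : {linear g -> R^o}) v w : (forall u, u \in W -> psi u = 0) ->
  v - w \in W -> psi v = psi w.
  by move=> psiW /psiW /eqP; rewrite linearB subr_eq0 => /eqP.
rewrite [RHS](eq_bigr (fun i => \sum_j (phi0 j (b i) : R) * (phi i (f b0`_j) : R))); last first.
  move=> i _; rewrite (congW (phi i) _ (f (\sum_j (phi0 j (b i) : R) *: b0`_j))) //.
  - by rewrite !linear_sum; apply: eq_bigr => j _; rewrite !linearZ.
  - exact: phiW.
  - by rewrite -linearB fW // dec0.
rewrite exchange_big; apply: eq_bigr => j _ /=.
rewrite (congW (phi0 j) _ (\sum_i (phi i (f b0`_j) : R) *: b i)); first last.
- by rewrite Udec // fU.
- exact: phi0W.
rewrite linear_sum; apply: eq_bigr => i _; rewrite linearZ /=.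
exact: mulrC.
Qed.

End QuotientTrace.

(** * Coordinate flags and nilpotency *)

Section Flag.
Variables (R : fieldType) (g : lieAlgType R) (e : 6.-tuple g).
Hypothesis be : basis_of fullv e.

(** This is the span of the first [j] vectors of [e], given by the equations that cut it out, so
    that membership is a condition on coordinates. *)
Definition flag (j : nat) : {vspace g} :=
  (\bigcap_(k < 6 | (j <= k)%N) lker (linfun (coord e k : g -> R^o)))%VS.

Lemma flagP j v :
  reflect (forall k, (j <= k < 6)%N -> coords e v 0 (inord k) = 0) (v \in flag j).
Proof.
apply: (iffP idP) => [vj k /andP[jk k6] | vj].
  rewrite mxE; have /subv_bigcapP/(_ (inord k)) : (<[v]> <= flag j)%VS.
    by rewrite -memvE.
  rewrite inordK // => /(_ jk).
  by rewrite -memvE memv_ker lfunE /= => /eqP.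
rewrite memvE; apply/subv_bigcapP => k jk; rewrite -memvE memv_ker lfunE /=.
by have := vj k; rewrite jk ltn_ord inord_val mxE => ->.
Qed.

Lemma mem_flag_comb j (x : 'rV[R]_6) :
  (forall k, (j <= k < 6)%N -> x 0 (inord k) = 0) -> comb e x \in flag j.
Proof. by move=> x0; apply/flagP => k jk; rewrite coords_comb // x0. Qed.

Lemma flag0 : flag 0 = 0%VS.
Proof.
apply/eqP; rewrite -subv0; apply/subvP => v /flagP v0.
rewrite -(comb_coords v be) (_ : coords e v = 0) ?linear0 ?mem0v //.
by apply: eq_row6 => k k6; rewrite v0 // row0E.
Qed.

Lemma flag6 : flag 6 = fullv.
Proof.
apply/eqP; rewrite eqEsubv subvf; apply/subvP => v _; apply/flagP => k.
by rewrite leqNgt => /andP[/negP].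
Qed.

Lemma liev_flag phi i j k : frame e phi ->
  (forall x y : 'rV[R]_6, (forall l, (i <= l < 6)%N -> x 0 (inord l) = 0) ->
     (forall l, (j <= l < 6)%N -> y 0 (inord l) = 0) ->
     forall l, (k <= l < 6)%N -> form_eval phi`_l x y = 0) ->
  (liev (flag i) (flag j) <= flag k)%VS.
Proof.
move=> [_ br] H; apply/lievP => v w /flagP vi /flagP wj.
rewrite -(comb_coords v be) -(comb_coords w be) br mem_flag_comb // => l /andP[kl l6].
by rewrite str_bracketE // H ?kl ?oppr0.
Qed.

End Flag.

Lemma lievS (R : fieldType) (g : lieAlgType R) (U U' W W' : {vspace g}) :
  (U <= U')%VS -> (W <= W')%VS -> (liev U W <= liev U' W')%VS.
Proof.
move=> /subvP UU' /subvP WW'; apply/lievP => u w uU wW.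
by rewrite mem_liev ?UU' ?WW'.
Qed.

(** Without c, b, x and y, bracketing with g lowers the flag from dimension 6 to 4, then to 2, then
    to 0. *)
Lemma lie_nilpotent_gen (R : fieldType) (g : lieAlgType R) (e : 6.-tuple g)
    (s p q r t r' t' k l m n : R) :
  frame e (eqs_gen 0 s p q 0 0 r t r' t' 0 k l m n) -> nilpotent (@fullv R g).
Proof.
move=> fe; have be := fe.1.
have step i j : (i, j) \in [:: (6, 4); (4, 2); (2, 0)]%N ->
    (liev (@fullv R g) (flag e i) <= flag e j)%VS.
  rewrite -(flag6 e) !inE => ij; apply: (liev_flag be fe) => x y _ yi h /andP[jh h6].
  rewrite (eqs_genE _ _ _ _ _ _ _ _ _ _ _ _ _ _ _
             (fun _ _ => erefl) (fun _ _ => erefl)) //.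
  case/or3P: ij yi jh => /eqP[-> ->] yi; move: h h6; apply: forall_lt6 => //= _;
    rewrite /ev_gen /minor /=; try rewrite (yi 5%N isT); try rewrite (yi 4%N isT);
    try rewrite (yi 3%N isT); try rewrite (yi 2%N isT); ring.
exists 3%N; apply/eqP; rewrite -subv0 -(flag0 be) /=.
apply: subv_trans (step 2%N 0%N isT); apply: lievS => //.
apply: subv_trans (step 4%N 2%N isT); apply: lievS => //.
by apply: subv_trans (step 6%N 4%N isT); rewrite flag6.
Qed.

(** * A basis adapted to the complex structure *)

Section JFree.
Variables (R : realFieldType) (V : vectType R) (J : 'End(V)).
Hypothesis JJ : forall x, J (J x) = - x.

(** J acts on the quotient by the stable span of [s], and has no eigenvector there: an eigenvalue a
    would satisfy 1 + a^2 = 0 in an ordered field. *)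
Lemma J_free_cons (s : seq V) u : (forall v, v \in <<s>>%VS -> J v \in <<s>>%VS) ->
  free s -> u \notin <<s>>%VS ->
  free (J u :: u :: s) /\
  (forall v, v \in <<J u :: u :: s>>%VS -> J v \in <<J u :: u :: s>>%VS).
Proof.
move=> Js fs us; split; last first.
  move=> v; rewrite !span_cons => /memv_addP[_ /vlineP[a ->] [w + ->]].
  move=> /memv_addP[_ /vlineP[b ->] [w' w's ->]].
  rewrite !linearD !linearZ /= JJ scalerN addrCA memv_add ?memvZ ?memv_line //.
  by rewrite memv_add ?memvN ?memvZ ?memv_line ?Js.
rewrite !free_cons us fs !andbT; apply/negP.
rewrite span_cons => /memv_addP[_ /vlineP[a ->] [w ws Ju]].
have e1 : - u = a *: (a *: u + w) + J w.
  by rewrite -Ju -JJ {1}Ju linearD linearZ.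
have : (1 + a ^+ 2) *: u \in <<s>>%VS.
  have -> : (1 + a ^+ 2) *: u = - (a *: w + J w).
    apply/eqP; rewrite -subr_eq0 opprK scalerDl scale1r -addrA.
    have -> : a ^+ 2 *: u + (a *: w + J w) = - u.
      by rewrite [RHS]e1 scalerDr scalerA -expr2 addrA.
    by rewrite subrr.
  by rewrite memvN memvD ?memvZ ?Js.
have a0 : 1 + a ^+ 2 != 0 by rewrite lt0r_neq0 // ltr_wpDr ?sqr_ge0.
by move/(memvZ (1 + a ^+ 2)^-1); rewrite scalerA mulVf // scale1r (negPf us).
Qed.

End JFree.

Section JFrame.
Variables (R : realFieldType) (g : lieAlgType R) (J : 'End(g)).
Variables (n : {vspace g}) (z : g).
Hypothesis Jcs : complex_structure J.
Hypothesis dg : \dim {:g} = 6%N.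
Hypothesis dn : \dim n = 5%N.
Hypothesis n_ideal : is_ideal n.
Hypothesis z0 : z != 0.
Hypothesis n1 : lcs n 1 = <[z]>%VS.
Hypothesis zn : z \in n.
Hypothesis Jzn : J z \in n.
Hypothesis z_central : forall x, bracket x z = 0.

Let JJ : forall x, J (J x) = - x := Jcs.1.

Lemma J_basis : exists u Y,
  [/\ [/\ u \in n, J u \in n & Y \in n], J Y \notin n &
      basis_of fullv [:: z; J z; u; J u; Y; - J Y]].
Proof.
have sub_lt (s : seq g) (U : {vspace g}) : (size s < \dim U)%N ->
    exists2 v, v \in U & v \notin <<s>>%VS.
  move=> sU; suff /subvPn[v] : ~~ (U <= <<s>>)%VS by exists v.
  by apply/negP => /dimvS /leq_trans/(_ (dim_span s)); rewrite leqNgt sU.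
have J0 v : v \in <<[::]>>%VS -> J v \in <<[::]>>%VS.
  by rewrite span_nil !memv0 => /eqP ->; rewrite linear0.
have zs : z \notin <<[::]>>%VS by rewrite span_nil memv0.
have [f1 J1] := J_free_cons JJ J0 (nil_free _) zs.
have J_inj : lker J == 0%VS.
  apply/lker0P => x y Jxy; apply: oppr_inj; by rewrite -!JJ Jxy.
(* Two subspaces of dimension 5 in dimension 6 meet in dimension at least 4, more than the 2 of the
   span of z and J z. *)
have [u unJ us1] : exists2 u, u \in (n :&: J @: n)%VS & u \notin <<[:: J z; z]>>%VS.
  apply: sub_lt => /=; have := dimv_sum_cap n (J @: n).
  rewrite limg_dim_eq ?(eqP J_inj) ?capv0 // dn.
  by have := dimvS (subvf (n + J @: n)); rewrite dg => + H; lia.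
move: unJ; rewrite memv_cap => /andP[un /memv_imgP[v vn uJv]].
have Jun : J u \in n by rewrite uJv JJ memvN.
have [f2 J2] := J_free_cons JJ J1 f1 us1.
have [Y Yn Ys] : exists2 Y, Y \in n & Y \notin <<[:: J u; u; J z; z]>>%VS.
  by apply: sub_lt; rewrite dn.
have [f3 _] := J_free_cons JJ J2 f2 Ys.
exists u, Y; split=> //.
  apply/negP => JYn; have : (<<[:: J Y; Y; J u; u; J z; z]>> <= n)%VS.
    by apply/span_subvP => w; rewrite !inE => /or4P[/eqP->|/eqP->|/eqP->|/or3P[]/eqP->].
  by move=> /dimvS; rewrite (eqP f3) dn.
have f4 : free [:: - J Y; Y; J u; u; J z; z].
  by move: f3; rewrite !free_cons memvN.
have f5 : free [:: z; J z; u; J u; Y; - J Y].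
  by rewrite -(perm_free (permEl (perm_rev _))); exact: f4.
by rewrite basisEfree f5 subvf dg.
Qed.

Lemma J_frame : exists (e : 6.-tuple g) (c s p q x y r t b k l m h : R),
  [/\ frame e (eqs_gen c s p q x y r t (p - t) (r + q) b k l m h),
      flag e 5 = n & e`_0 = z].
Proof.
have [u [Y [[un Jun Yn] JYn be0]]] := J_basis.
have [X XE] : exists X, X = - J Y by exists (- J Y).
rewrite -XE in be0; have JY : J Y = - X by rewrite XE opprK.
have JX : J X = Y by rewrite XE linearN /= JJ opprK.
have Xn : X \notin n by rewrite XE memvN.
pose e : 6.-tuple g := [tuple z; J z; u; J u; Y; X].
have be : basis_of fullv e by exact: be0.
(* Vectors are written as coordinate lists, which turns integrability into scalar equations. *)
pose K (s : seq R) := comb e (\row_k s`_k).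
have combE (v : 'rV[R]_6) : comb e v = v 0 (inord 0) *: z + v 0 (inord 1) *: J z
    + v 0 (inord 2) *: u + v 0 (inord 3) *: J u + v 0 (inord 4) *: Y
    + v 0 (inord 5) *: X.
  by rewrite /comb big_ord6 !inordK.
have KE s : K s = s`_0 *: z + s`_1 *: J z + s`_2 *: u + s`_3 *: J u
                  + s`_4 *: Y + s`_5 *: X.
  by rewrite /K combE !mxE !inordK.
have K0 s : K s = 0 -> forall i, (i < 6)%N -> s`_i = 0.
  move=> Ks0 i i6; have := coords_comb (\row_k s`_k) be; rewrite -/(K s) Ks0 linear0.
  by move=> /rowP/(_ (inord i)); rewrite !mxE inordK.
have mem_n v : (v \in n) = (coords e v 0 (inord 5) == 0).
  pose w := coords e v; rewrite -(comb_coords v be) coords_comb // -/w.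
  rewrite combE; move: w => w.
  have S : w 0 (inord 0) *: z + w 0 (inord 1) *: J z + w 0 (inord 2) *: u
      + w 0 (inord 3) *: J u + w 0 (inord 4) *: Y \in n by rewrite !memvD ?memvZ.
  rewrite (rpredDl _ S).
  apply/idP/eqP => [|->]; last by rewrite scale0r mem0v.
  apply: contraTeq => a0; apply: contraNN Xn => aXn.
  by rewrite -[X](scalerK a0) memvZ.
have flag_n : flag e 5 = n.
  apply/vspaceP => v; rewrite mem_n; apply/flagP/eqP => [|v5 i /andP[i5 i6]]; first exact.
  by have -> : i = 5%N by apply/eqP; rewrite eqn_leq i5 -ltnS i6.
have nK v : v \in n -> exists a0 a1 a2 a3 a4, v = K [:: a0; a1; a2; a3; a4; 0].
  rewrite mem_n => /eqP v5; pose a i := coords e v 0 (inord i).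
  exists (a 0%N), (a 1%N), (a 2%N), (a 3%N), (a 4%N).
  rewrite -{1}(comb_coords v be); congr (comb e _); apply: eq_row6.
  by apply: forall_lt6; rewrite [RHS]mxE inordK.
have bK v w : v \in n -> w \in n -> exists a, bracket v w = a *: z.
  by move=> vn wn; apply/vlineP; rewrite -n1 mem_liev.
have bXK v : v \in n -> exists a0 a1 a2 a3 a4, bracket X v = K [:: a0; a1; a2; a3; a4; 0].
  by move=> vn; apply: nK; apply: n_ideal.
have KJ s : J (K s) = K [:: - s`_1; s`_0; - s`_3; s`_2; s`_5; - s`_4].
  rewrite !KE /= !linearD !linearZ /= !JJ JX JY !scalerN !scaleNr.
  by rewrite [LHS](ACl (2*1*4*3*6*5)%AC).
have KD s s' : K s + K s' = K [:: s`_0 + s'`_0; s`_1 + s'`_1; s`_2 + s'`_2;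
    s`_3 + s'`_3; s`_4 + s'`_4; s`_5 + s'`_5].
  rewrite /K -linearD; congr (comb e _); apply: eq_row6.
  by apply: forall_lt6; rewrite !mxE inordK.
have KN s : - K s = K [:: - s`_0; - s`_1; - s`_2; - s`_3; - s`_4; - s`_5].
  rewrite /K -linearN; congr (comb e _); apply: eq_row6.
  by apply: forall_lt6; rewrite !mxE inordK.
have zK a : a *: z = K [:: a; 0; 0; 0; 0; 0].
  by rewrite KE /= !scale0r !addr0.
have z_central' x : bracket z x = 0 by rewrite bracketC z_central oppr0.
have [c Ec] := bK _ _ Jzn Yn.
have [s Es] := bK _ _ un Jun.
have [p Ep] := bK _ _ un Yn.
have [q Eq] := bK _ _ Jun Yn.
have [c1 Ec1] := bK _ _ Jzn un.
have [c2 Ec2] := bK _ _ Jzn Jun.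
have [r [t [x [y [h' EXu]]]]] := bXK _ un.
have [a0 [a1 [a2 [a3 [a4 EXu']]]]] := bXK _ Jun.
have [m [h [k [l [b EXY]]]]] := bXK _ Yn.
have [b0 [b1 [b2 [b3 [b4 EXz]]]]] := bXK _ Jzn.
(* Integrability at (u, z) reads [J u, J z] = J [u, J z]: the left side is a multiple of z and the
   right side of J z, so both vanish. *)
have [c10 c20] : c1 = 0 /\ c2 = 0.
  have := Jcs.2 u z; rewrite !z_central linear0 subr0 subr0 bracketC Ec2.
  rewrite (bracketC u) Ec1 -!scaleNr !zK KJ !(KN, KD) /= => /K0 H.
  by have /= h0 := H 0%N isT; have /= h1 := H 1%N isT; split; lra.
(* Here [Y, J z] = J [X, J z], that is [X, J z] = c J z. *)
have := Jcs.2 X z; rewrite !z_central linear0 JX subr0 subr0 bracketC Ec EXz.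
rewrite -!scaleNr !zK KJ !(KN, KD) /= => /K0 Hz.
(* This gives [X, J u] = J [X, u] + p z + q J z, hence r' = p - t and t' = r + q. As [X, J u] has no
   component on X, [X, u] has none on Y. *)
have := Jcs.2 X u; rewrite JX (bracketC Y) Eq (bracketC Y) Ep EXu EXu'.
rewrite -!scaleNr !zK !KJ !(KN, KD) /= => /K0 Hu.
exists e, c, s, p, q, x, y, r, t, b, k, l, m, h; split=> //.
pose T (i j : nat) : seq R := match i, j with
  | 1%N, 4%N => [:: c; 0; 0; 0; 0; 0]
  | 2%N, 3%N => [:: s; 0; 0; 0; 0; 0]
  | 2%N, 4%N => [:: p; 0; 0; 0; 0; 0]
  | 3%N, 4%N => [:: q; 0; 0; 0; 0; 0]
  | 1%N, 5%N => [:: 0; - c; 0; 0; 0; 0]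
  | 2%N, 5%N => [:: - r; - t; - x; - y; 0; 0]
  | 3%N, 5%N => [:: - (p - t); - (r + q); y; - x; 0; 0]
  | 4%N, 5%N => [:: - m; - h; - k; - l; - b; 0]
  | _, _ => [:: 0; 0; 0; 0; 0; 0]
  end.
apply: (frame_of_table
  (@eqs_genE R c s p q x y r t (p - t) (r + q) b k l m h)
  (T := fun i j => nth 0 (T i j)) be (@eqs_genxx R c s p q x y r t (p - t) (r + q) b k l m h)).
  apply: forall_pairs6; apply: forall_lt6;
    cbv beta match fix zeta delta [T minor nth eqn Nat.pred ev_gen]; ring.
move=> i j ij; have -> : bracket e`_i e`_j = K (T i j); last by rewrite KE.
have eqK s1 s2 : (forall i, (i < 6)%N -> s1`_i = s2`_i) -> K s1 = K s2.
  move=> s12; congr (comb e _); apply/rowP => i'; rewrite !mxE.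
  exact: s12.
move: i j ij; apply: forall_pairs6; rewrite [LHS]/= ?z_central' ?Ec1 ?Ec2 ?c10 ?c20 ?Ec ?Es ?Ep ?Eq.
all: rewrite ?(bracketC _ X) ?EXz ?EXu ?EXu' ?EXY.
all: rewrite -?(scale0r z) ?zK ?KN; apply: eqK; apply: forall_lt6.
all: rewrite /= ?oppr0 //.
all: move: (Hz 0%N isT) (Hz 1%N isT) (Hz 2%N isT) (Hz 3%N isT) (Hz 5%N isT).
all: move: (Hu 0%N isT) (Hu 1%N isT) (Hu 2%N isT) (Hu 3%N isT) (Hu 4%N isT) (Hu 5%N isT).
all: by move=> /=; lra.
Qed.

End JFrame.

(** * From an adapted complex structure to the list *)

Section Forward.
Variables (R : realFieldType) (g : lieAlgType R).

(** A nonzero n^2 would fill the line n^1, and the lower central series would be stationary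
    there. *)
Lemma lcs2_eq0 (n : {vspace g}) : is_ideal n -> nilpotent n ->
  \dim (lcs n 1) = 1%N -> lcs n 2 = 0%VS.
Proof.
move=> ni [l nl] d1.
have lcs2S : (lcs n 2 <= lcs n 1)%VS.
  by apply/lievP => u w _ wn; apply: (is_ideal_lcs ni (l := 1)).
apply/eqP; rewrite -dimv_eq0; apply: contraTT isT => d2.
have E : lcs n 2 = lcs n 1.
  by apply/eqP; rewrite eqEdim lcs2S d1 lt0n.
have lE k : lcs n k.+1 = lcs n 1.
  by elim: k => [//|k IH]; rewrite -[LHS]/(liev n (lcs n k.+1)) IH.
have : \dim (lcs n l.+1) = 0%N.
  rewrite -[lcs n _]/(liev n (lcs n l)) nl; apply/eqP; rewrite dimv_eq0 -subv0.
  by apply/lievP => u w _; rewrite memv0 => /eqP ->; rewrite linear0 mem0v.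
by rewrite lE d1.
Qed.

Lemma adapted_listed : \dim {:g} = 6%N -> strongly_unimodular g ->
  almost_nilpotent g -> \dim (lcs (nilradical g) 1) = 1%N ->
  (exists J : 'End(g), adapted_complex_structure J) -> listed g.
Proof.
move=> dg [_ su] [_ an] d1 [J [Jcs Jn1]].
have [ni nn nmax] := nilradicalP g; set n := nilradical g in su an d1 ni nn nmax Jn1 *.
have dn : \dim n = 5%N by move: an; rewrite dg => -[].
have n2 := lcs2_eq0 ni nn d1.
pose z := vpick (lcs n 1).
have z0 : z != 0 by rewrite vpick0 -dimv_eq0 d1.
have zn1 : z \in lcs n 1 := memv_pick _.
have n1 : lcs n 1 = <[z]>%VS.
  by apply/esym/eqP; rewrite eqEdim -memvE zn1 d1 dim_vline z0.
have n1n : (lcs n 1 <= n)%VS by apply/lievP => u w un wn; apply: ni.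
have zn : z \in n := subvP n1n _ zn1.
have Jzn : J z \in n by apply: (subvP Jn1); rewrite memv_img.
(* Since n^2 = 0, the trace of ad x on n^1 / n^2 is its eigenvalue on z. *)
have z_central x : bracket x z = 0.
  have /vlineP[a xz] : bracket x z \in <[z]>%VS.
    by rewrite -n1; apply: (is_ideal_lcs ni (l := 1)).
  have fz : free [tuple z] by rewrite seq1_free.
  have cz : coord [tuple z] ord0 z = 1 by have := coord_free ord0 ord0 fz.
  have := su x 1%N; rewrite n2 n1.
  rewrite (quotient_traceE (b := fun _ : 'I_1 => z) (phi := fun _ => coord [tuple z] ord0)).
  - by rewrite big_ord1 /= xz linearZ /= cz mulr1 => ->; rewrite scale0r.
  - exact: sub0v.
  - by move=> v /vlineP[b ->]; rewrite linearZ /= xz memvZ ?memvZ ?memv_line.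
  - by move=> v; rewrite memv0 => /eqP ->; rewrite linear0 mem0v.
  - by move=> _; rewrite memv_line.
  - by move=> _ v; rewrite memv0 => /eqP ->; rewrite linear0.
  - move=> v /vlineP[b ->]; rewrite big_ord1 /=.
    have -> : coord [tuple z] ord0 (b *: z) = b by rewrite linearZ /= cz mulr1.
    by rewrite subrr mem0v.
have [e [c [s [p [q [x [y [r [t [b [k [l [m [h [fe flag_n e0]]]]]]]]]]]]]]] :=
  J_frame Jcs dg dn ni z0 n1 zn Jzn z_central.
have be := fe.1.
have [E1 E2 E3 E4] := eqs_gen_jacobi fe.
have ek (i : 'I_6) : e`_i = comb e (delta_mx 0 i) by rewrite comb_delta.
have coord_e (i j : 'I_6) : coord e j e`_i = (i == j)%:R.
  by rewrite coord_free // (basis_free be).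
have en (i : 'I_6) : i != ord_max -> e`_i \in n.
  move=> i5; rewrite -flag_n; apply/flagP => j /andP[j5 j6].
  rewrite mxE coord_e; case: eqP => // E; case/negP: i5.
  by rewrite E -val_eqE /= inordK //; apply/eqP; lia.
apply: (@listed_gen R g e c s p q x y r t b k l m h) => //.
- by move/eqP: E2; rewrite mulf_eq0 pnatr_eq0 /= => /eqP.
(* The classes of z', u, u' and Y form a basis of n / n^1, on which ad X has trace c + 2 x + b; the
   shift of the index skips z. *)
- pose b' (i : 'I_4) := e`_(inord i.+1 : 'I_6).
  pose phi' (i : 'I_4) : {linear g -> R^o} := coord e (inord i.+1).
  have := su e`_5 0%N; rewrite (quotient_traceE (b := b') (phi := phi')).
  + pose d i l : R := if eqn l i then 1 else 0.
    have dE (i : nat) : (i < 6)%N -> forall j, (j < 6)%N ->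
      (delta_mx 0 (inord i) : 'rV[R]_6) 0 (inord j) = d i j.
      move=> i6 j j6; rewrite -[delta_mx _ _]/(f_ i.+1) f_E // /d -[eqn j i]/(j == i).
      by case: eqP.
    have diag i : (i < 6)%N -> coord e (inord i) (bracket e`_5 e`_(inord i : 'I_6)) =
        - ev_gen c s p q x y r t (p - t) (r + q) b k l m h (d 5%N) (d i) i.
      move=> i6.
      have -> : e`_5 = e`_(inord 5 : 'I_6) by rewrite inordK.
      have -> v : coord e (inord i) v = coords e v 0 (inord i) by rewrite mxE.
      rewrite !ek fe.2 coords_comb //.
      exact: (str_bracket_ev (@eqs_genE _ _ _ _ _ _ _ _ _ _ _ _ _ _ _ _)
                (dE 5%N isT) (dE i i6)).
    have -> : \sum_i phi' i (bracket e`_5 (b' i)) = \sum_(i < 4)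
        - ev_gen c s p q x y r t (p - t) (r + q) b k l m h (d 5%N) (d i.+1) i.+1.
      apply: eq_bigr => i _; apply: diag; have := ltn_ord i; lia.
    move=> tr0; rewrite -[RHS]tr0 !big_ord_recl big_ord0 /=.
    rewrite /ev_gen /minor /d /=; ring.
  + exact: n1n.
  + by move=> v vn; apply: ni.
  + by rewrite n1 => v /vlineP[a ->]; rewrite linearZ /= z_central scaler0 mem0v.
  + by move=> i; apply: en; rewrite -val_eqE /= inordK; have := ltn_ord i; lia.
  + move=> i v; rewrite n1 => /vlineP[a ->]; rewrite linearZ /= -e0.
    rewrite (coord_e ord0 (inord i.+1)) -val_eqE /= inordK ?scaler0 //.
    by have := ltn_ord i; lia.
  + rewrite n1 -e0 -flag_n => v /flagP vn.
    have {1}-> : v = \sum_j coords e v 0 j *: e`_j by rewrite -[LHS](comb_coords v be).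
    rewrite big_ord_recl big_ord_recr /= addrA addrAC.
    have -> : coords e v 0 (lift ord0 ord_max) = 0 :> R.
      by rewrite -[lift _ _]inord_val vn.
    rewrite scale0r addr0 -addrA.
    rewrite [X in _ + X](_ : _ = 0) ?addr0 ?memvZ ?memv_line //.
    apply/eqP; rewrite subr_eq0; apply/eqP/eq_bigr => i _; rewrite /b' mxE.
    have -> : inord i.+1 = lift ord0 (widen_ord (leqnSn 4) i) :> 'I_6.
      by apply: val_inj; rewrite /= inordK //; have := ltn_ord i; lia.
    by [].
- move=> [c0 b0 x0 y0]; move: fe; rewrite c0 b0 x0 y0 => /lie_nilpotent_gen.
  by move/(nmax fullv) => /(_ (fun _ _ _ => memvf _))/dimvS; rewrite dg dn.
- move=> [c0 s0 p0 q0].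
  suff : lcs n 1 = 0%VS by move=> n10; move: d1; rewrite n10 dimv0.
  apply/eqP; rewrite -subv0 -(flag0 be) -flag_n.
  apply: (liev_flag be fe) => u v u5 v5 i i6.
  rewrite (eqs_genE _ _ _ _ _ _ _ _ _ _ _ _ _ _ _
             (fun _ _ => erefl) (fun _ _ => erefl)) // c0 s0 p0 q0.
  move: i i6; apply: forall_lt6; rewrite /ev_gen /minor /= ?(u5 5%N isT) ?(v5 5%N isT);
    ring.
Qed.
End Forward.

(** * Complex structures on the listed algebras *)

Section Backward.
Variables (R : fieldType) (g : lieAlgType R) (e : 6.-tuple g).
Variables (phi : seq 'M[R]_6) (B : (nat -> R) -> (nat -> R) -> nat -> R).
Variables (lam : R) (w : nat -> R) (T : (nat -> R) -> nat -> R).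
Hypothesis phiE : evaluates phi B.
Hypothesis fe : frame e phi.
Hypothesis B5 : forall u v, B u v 5%N = 0.
Hypothesis B1 : forall u v, u 5%N = 0 -> v 5%N = 0 ->
  forall k, (1 <= k < 6)%N -> B u v k = 0.
Hypothesis B0 : forall u v, (forall i, (1 <= i < 6)%N -> v i = 0) ->
  forall k, (k < 6)%N -> B u v k = 0.
Hypothesis lam0 : lam != 0.
Hypothesis w0 : exists2 k, (k < 6)%N & w k != 0.
Hypothesis wlam : let d l := if eqn l 5 then 1 else 0 in
  forall k, (k < 6)%N -> B d (fun i => - B d w i) k = - (lam * w k).

Let be : basis_of fullv e := fe.1.
Let co (x : 'rV[R]_6) i := x 0 (inord i).

Let brE x y k : (k < 6)%N -> str_bracket phi x y 0 (inord k) = - B (co x) (co y) k.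
Proof. exact: str_bracket_ev. Qed.

(** The eigenvector [w] stays in every term of the lower central series. The square of ad f_6 is
    used because ad f_6 has no real eigenvector in a rotation plane, while its square is scalar
    there. *)
Lemma full_not_nilpotent : ~ nilpotent (@fullv R g).
Proof.
move=> [l nl].
pose d l := if eqn l 5 then 1 else 0 : R.
pose x := comb e (\row_k d k); pose y := comb e (\row_k w k).
have rowE (u : nat -> R) k : (k < 6)%N -> (\row_(i < 6) u i : 'rV[R]_6) 0 (inord k) = u k.
  by move=> k6; rewrite mxE inordK.
have xxy : bracket x (bracket x y) = lam *: y.
  rewrite !fe.2 /y -linearZ; congr (comb e _); apply: eq_row6 => k k6.
  have S := str_bracket_ev phiE (rowE d) (str_bracket_ev phiE (rowE d) (rowE w)).
  by rewrite S // wlam // opprK !mxE inordK.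
have y0 : y != 0.
  have [k k6] := w0; apply: contraNneq => y0.
  have /rowP/(_ (inord k)) : coords e y = 0 by rewrite y0 linear0.
  by rewrite coords_comb // rowE // mxE => ->.
have yl k : y \in lcs (@fullv R g) k.
  elim: k => [|k IH]; first exact: memvf.
  rewrite -[y](scalerK lam0) -xxy memvZ //.
  apply: is_ideal_lcs => [v u _|]; first exact: memvf.
  by rewrite mem_liev ?memvf.
by have := yl l; rewrite nl memv0 (negPf y0).
Qed.

Lemma nilradical_frame : nilradical g = flag e 5.
Proof.
have [ni nn nmax] := nilradicalP g; set n := nilradical g in ni nn nmax *.
have coE v i : co (coords e v) i = coords e v 0 (inord i) by [].
have brK v u : bracket v u = comb e (str_bracket phi (coords e v) (coords e u)).
  by rewrite -fe.2 !comb_coords.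
have fn : (flag e 5 <= n)%VS.
  apply: nmax.
    move=> x y /flagP y5; rewrite brK; apply: mem_flag_comb => // k /andP[k5 k6].
    by rewrite brE // (_ : k = 5%N) ?B5 ?oppr0 //; lia.
  exists 2%N; apply/eqP; rewrite -subv0 -(flag0 be) /=.
  (* Brackets within [flag e 5] lie on the line of e_0 by [B1], and this line is central by [B0]. *)
  apply: subv_trans (_ : (liev (flag e 5) (flag e 1) <= _)%VS).
    apply: lievS => //; apply: (liev_flag be fe) => x y x5 y5 k k6.
    have [_ {}k6'] := andP k6.
    by rewrite (phiE (u := co x) (v := co y)) // B1 // /co ?x5 ?y5.
  apply: (liev_flag be fe) => x y x5 y1 k k6.
  by rewrite (phiE (u := co x) (v := co y)) // B0.
apply/eqP; rewrite eqEsubv fn andbT; apply/subvP => v vn.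
apply/flagP => k /andP[k5 k6]; have -> : k = 5%N by lia.
apply/eqP; apply: contraPT (full_not_nilpotent) => v5; apply.
suff -> : fullv = n by [].
apply/eqP; rewrite eqEsubv subvf andbT; apply/subvP => x _.
pose a := coords e x 0 (inord 5) / coords e v 0 (inord 5).
rewrite -(subrK (a *: v) x) memvD ?memvZ //.
apply: (subvP fn); apply/flagP => i /andP[i5 i6]; have -> : i = 5%N by lia.
rewrite linearB linearZ /= /a.
by move: (coords e x) (coords e v) v5 => x' v' v'5; rewrite !mxE divfK ?subrr.
Qed.

Hypothesis T_ext : forall u v, (forall i, (i < 6)%N -> u i = v i) ->
  forall k, (k < 6)%N -> T u k = T v k.
Hypothesis T_lin : forall a u v k, (k < 6)%N ->
  T (fun i => a * u i + v i) k = a * T u k + T v k.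
Hypothesis TT : forall u k, (k < 6)%N -> T (T u) k = - u k.
Hypothesis T_int : forall u v k, (k < 6)%N ->
  - B (T u) (T v) k - T (fun i => - B (T u) v i) k
  - T (fun i => - B u (T v) i) k + B u v k = 0.
Hypothesis T_adapted : forall u, (forall i, (1 <= i < 6)%N -> u i = 0) ->
  T u 5%N = 0.

Let Tm (x : 'rV[R]_6) : 'rV[R]_6 := \row_k T (co x) k.

Let TmE (x : 'rV[R]_6) u : (forall i, (i < 6)%N -> x 0 (inord i) = u i) ->
  forall k, (k < 6)%N -> Tm x 0 (inord k) = T u k.
Proof. by move=> xu k k6; rewrite mxE inordK //; apply: T_ext. Qed.

Let Jf v := comb e (Tm (coords e v)).

Let Jf_linear : linear Jf.
Proof.
move=> a v u; rewrite /Jf -linearP /=; congr (comb e _); apply: eq_row6 => k k6.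
rewrite (TmE (u := fun i => a * co (coords e v) i + co (coords e u) i)) //.
  by rewrite T_lin // !mxE !inordK.
by move=> i i6; rewrite linearP /co !mxE.
Qed.

HB.instance Definition _ := @GRing.isLinear.Build R g g *:%R Jf Jf_linear.

(** Like [B], [T] acts on coordinate functions, so its identities are checked by computation;
    [T_ext] makes it well defined on rows, which only see the indices below 6. *)
Lemma frame_adapted : exists J : 'End(g),
  (forall x k, (k < 6)%N -> coords e (J (comb e x)) 0 (inord k)
     = T (fun i => x 0 (inord i)) k) /\
  adapted_complex_structure J.
Proof.
exists (linfun Jf).
have JE x : linfun Jf (comb e x) = comb e (Tm x) by rewrite lfunE /= /Jf coords_comb.
split=> [x k k6|]; first by rewrite JE coords_comb // (TmE (u := co x)).
split.
  split=> [v | v u].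
    rewrite -(comb_coords v be) !JE -linearN; congr (comb e _); apply: eq_row6 => k k6.
    by rewrite (TmE (TmE (u := co (coords e v)) _)) // TT // [RHS]mxE.
  rewrite -(comb_coords v be) -(comb_coords u be).
  move: (coords e v) (coords e u) => x y.
  rewrite !JE !fe.2 !JE -!linearB -[RHS](linear0 (comb e)) /=; congr (comb e _).
  apply: eq_row6 => k k6; rewrite row0E -[RHS](T_int (co x) (co y) k6).
  have Tx z : forall i, (i < 6)%N -> Tm z 0 (inord i) = T (co z) i by apply: TmE.
  have S1 := str_bracket_ev phiE (Tx x) (Tx y).
  have S2 := TmE (str_bracket_ev phiE (Tx x) (fun _ _ => erefl)).
  have S3 := TmE (str_bracket_ev phiE (fun _ _ => erefl) (Tx y)).
  have rowNE (a : 'rV[R]_6) i : (- a) 0 i = - a 0 i by rewrite mxE.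
  by rewrite !rowDE !rowNE S1 // S2 // S3 // brE // opprK.
rewrite nilradical_frame; apply/subvP => _ /memv_imgP[v + ->].
have /subvP l1 : (lcs (flag e 5) 1 <= flag e 1)%VS.
  apply: (liev_flag be fe) => x y x5 y5 k k6; have [_ k6'] := andP k6.
  by rewrite (phiE (u := co x) (v := co y)) // B1 // /co ?x5 ?y5.
move=> /l1 /flagP v1; rewrite -(comb_coords v be) JE; apply: mem_flag_comb => // k /andP[k5 k6].
have -> : k = 5%N by lia.
by rewrite (TmE (u := co (coords e v))) // T_adapted.
Qed.

End Backward.

Section Tensors.
Variables (R : fieldType) (a : R).
Implicit Types u : nat -> R.

(** The list gives the coordinates of J v from those of v: J f_i = f_j puts u_i in position j and -
    u_j in position i, with positions counted from 0. *)
Definition J_4_6 u : seq R :=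
  [:: - u 1%N; u 0%N; - u 5%N; - u 4%N; u 3%N; u 2%N].

Definition J_4_7 u : seq R :=
  [:: - u 3%N; - u 2%N; u 1%N; u 0%N; - u 5%N; u 4%N].

Definition J_5_16 u : seq R :=
  [:: u 4%N; - u 2%N; u 1%N; - u 5%N; - u 0%N; u 3%N].

Definition J_6_51 u : seq R :=
  [:: - (a^-1 * u 1%N); a * u 0%N; - u 5%N; - u 4%N; u 3%N; u 2%N].

Definition J_6_158 u : seq R :=
  [:: - u 2%N; - u 3%N; u 0%N; u 1%N; - u 5%N; u 4%N].

Definition J_6_164 u : seq R :=
  [:: - (a^-1 * u 1%N); a * u 0%N; - u 4%N; - u 5%N; u 2%N; u 3%N].

End Tensors.

Ltac compute_ev :=
  cbv beta match fix zeta delta [minor nth eqn Nat.pred ev_gen ev_4_6 ev_4_7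
    ev_5_16 ev_6_25 ev_6_51 ev_6_158 ev_6_164
    J_4_6 J_4_7 J_5_16 J_6_51 J_6_158 J_6_164].

(* w = f_(k+1) is an eigenvector of (ad f_6)^2 for the eigenvalue lam, and tac
   proves identities between scalars. *)
Ltac prove_adapted phiE fe lam w k J tac :=
  apply: (frame_adapted (lam := lam) (w := nth 0 w) (T := fun u => nth 0 (J u))
            phiE fe);
  [by move=> ? ?; compute_ev
  | let u5 := fresh in let v5 := fresh in let h := fresh in
    let k1 := fresh in let k6 := fresh in
    move=> ? ? u5 v5 h /andP[k1 k6]; move: h k6 k1;
    apply: forall_lt6 => // _; compute_ev; rewrite ?u5 ?v5; ring
  | let vz := fresh in let z1 := fresh in let z2 := fresh in let z3 := fresh in
    let z4 := fresh in let z5 := fresh in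
    move=> ? ? vz; have z1 := vz 1%N isT; have z2 := vz 2%N isT;
    have z3 := vz 3%N isT; have z4 := vz 4%N isT; have z5 := vz 5%N isT;
    apply: forall_lt6; compute_ev; rewrite ?z1 ?z2 ?z3 ?z4 ?z5; ring
  | by rewrite ?oppr_eq0 ?mulf_neq0 ?oner_neq0
  | by exists k; rewrite //= oner_neq0
  | let d := fresh in
    move=> d; rewrite /d; apply: forall_lt6; compute_ev; ring
  | let uv := fresh in
    by move=> ? ? uv; apply: forall_lt6; compute_ev; rewrite !uv
  | move=> ? ? ?; apply: forall_lt6; compute_ev; ring
  | move=> ?; apply: forall_lt6; compute_ev; tac
  | move=> ? ?; apply: forall_lt6; compute_ev; tac
  | let uz := fresh in
    by move=> ? uz; compute_ev; rewrite !uz // ?oppr0 ?mulr0].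

Section Structures.
Variables (R : fieldType) (g : lieAlgType R) (e : 6.-tuple g) (a : R).

Definition adapted_by (T : (nat -> R) -> seq R) : Prop :=
  exists J : 'End(g),
  (forall x k, (k < 6)%N ->
     coords e (J (comb e x)) 0 (inord k) = (T (fun i => x 0 (inord i)))`_k) /\
  adapted_complex_structure J.

Lemma adapted_4_6 : frame e (eqs_4_6 R) -> adapted_by (@J_4_6 R).
Proof.
move=> fe.
prove_adapted (@eqs_4_6E R) fe (1 : R) [:: (0 : R); 1] 1%N (@J_4_6 R) ltac:(ring).
Qed.

Lemma adapted_4_7 : frame e (eqs_4_7 R) -> adapted_by (@J_4_7 R).
Proof.
move=> fe.
prove_adapted (@eqs_4_7E R) fe (-1 : R) [:: (0 : R); 1] 1%N (@J_4_7 R) ltac:(ring).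
Qed.

Lemma adapted_5_16 : frame e (eqs_5_16 R) -> adapted_by (@J_5_16 R).
Proof.
move=> fe.
prove_adapted (@eqs_5_16E R) fe (-1 : R) [:: (0 : R); 1] 1%N (@J_5_16 R) ltac:(ring).
Qed.

Lemma adapted_6_25 : frame e (eqs_6_25 R) -> adapted_by (@J_5_16 R).
Proof.
move=> fe.
prove_adapted (@eqs_6_25E R) fe (-1 : R) [:: (0 : R); 1] 1%N (@J_5_16 R) ltac:(ring).
Qed.

Lemma adapted_6_51 : a != 0 -> frame e (eqs_6_51 a) -> adapted_by (J_6_51 a).
Proof.
move=> a0 fe.
prove_adapted (@eqs_6_51E R a) fe (-1 : R) [:: (0 : R); 0; 0; 1] 3%N (J_6_51 a) ltac:(by field; rewrite ?a0).
Qed.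

Lemma adapted_6_158 : frame e (eqs_6_158 R) -> adapted_by (@J_6_158 R).
Proof.
move=> fe.
prove_adapted (@eqs_6_158E R) fe (1 : R) [:: (0 : R); 0; 1] 2%N (@J_6_158 R) ltac:(ring).
Qed.

Lemma adapted_6_164 : a != 0 -> frame e (eqs_6_164 a) -> adapted_by (J_6_164 a).
Proof.
move=> a0 fe.
prove_adapted (@eqs_6_164E R a) fe (-1 : R) [:: (0 : R); 0; 1] 2%N (J_6_164 a) ltac:(by field; rewrite ?a0).
Qed.

End Structures.

(** In the standard frame [comb e] is the identity, so a formula in coordinates gives the values of
    J on the vectors f_k themselves. *)
Lemma adapted_std (R : fieldType) (phi : seq 'M[R]_6) (phiP : is_str_eqs phi) T :
  (forall e : 6.-tuple (lie_of phiP), frame e phi -> adapted_by e T) ->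
  exists J : 'End(lie_of phiP),
    (forall (x : 'rV[R]_6) k, (k < 6)%N ->
       (J x : 'rV[R]_6) 0 (inord k) = (T (fun i => x 0 (inord i)))`_k) /\
    adapted_complex_structure J.
Proof.
have [e [fe eid]] := std_frame phiP => /(_ e fe)[J [JT Jad]].
have coords_id (x : 'rV[R]_6) : coords e x = x.
  by rewrite -[in LHS](eid x) (coords_comb _ fe.1).
by exists J; split=> // x k k6; rewrite -JT // eid coords_id.
Qed.

Ltac compute_J JT :=
  apply: eq_row6; apply: forall_lt6; rewrite JT //;
  cbv beta match fix zeta delta [nth J_4_6 J_4_7 J_5_16 J_6_51 J_6_158 J_6_164];
  rewrite ?[(- _ : 'M__) _ _]mxE ?[(_ *: _ : 'M__) _ _]mxE !f_E //=; ring.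

Theorem theorem3p2 (R : realType) :
  (forall g : lieAlgType R,
     \dim {:g} = 6%N ->
     strongly_unimodular g ->
     almost_nilpotent g ->
     \dim (lcs (nilradical g) 1) = 1%N ->
     ((exists J : 'End(g), adapted_complex_structure J) <->
      (lie_isomorphic g (s_4_6_R2 R) \/
       lie_isomorphic g (s_4_7_R2 R) \/
       lie_isomorphic g (s_5_16_R R) \/
       lie_isomorphic g (s_6_25 R) \/
       (exists a : R, 0 < a /\ lie_isomorphic g (s_6_51 a)) \/
       lie_isomorphic g (s_6_158 R) \/
       (exists a : R, 0 < a /\ lie_isomorphic g (s_6_164 a)))))
  /\
  ((exists J : 'End(s_4_6_R2 R),
        [/\ J (f_ 1) = f_ 2, J (f_ 3) = f_ 6, J (f_ 4) = f_ 5
          & adapted_complex_structure J]) /\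
     (exists J : 'End(s_4_7_R2 R),
        [/\ J (f_ 1) = f_ 4, J (f_ 2) = f_ 3, J (f_ 5) = f_ 6
          & adapted_complex_structure J]) /\
     (exists J : 'End(s_5_16_R R),
        [/\ J (f_ 1) = - f_ 5, J (f_ 2) = f_ 3, J (f_ 4) = f_ 6
          & adapted_complex_structure J]) /\
     (exists J : 'End(s_6_25 R),
        [/\ J (f_ 1) = - f_ 5, J (f_ 2) = f_ 3, J (f_ 4) = f_ 6
          & adapted_complex_structure J]) /\
     (forall a : R, 0 < a -> exists J : 'End(s_6_51 a),
        [/\ J (f_ 1) = a *: f_ 2, J (f_ 3) = f_ 6, J (f_ 4) = f_ 5
          & adapted_complex_structure J]) /\
     (exists J : 'End(s_6_158 R),
        [/\ J (f_ 1) = f_ 3, J (f_ 2) = f_ 4, J (f_ 5) = f_ 6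
          & adapted_complex_structure J]) /\
     (forall a : R, 0 < a -> exists J : 'End(s_6_164 a),
        [/\ J (f_ 1) = a *: f_ 2, J (f_ 3) = f_ 5, J (f_ 4) = f_ 6
          & adapted_complex_structure J])).
Proof.
split.
  move=> g dg su an d1; split=> [/(adapted_listed dg su an d1) H | H].
    case: H => [[e fe]|H]; first by left; apply: frame_iso fe.
    case: H => [[e fe]|H]; first by right; left; apply: frame_iso fe.
    case: H => [[e fe]|H]; first by do 2!right; left; apply: frame_iso fe.
    case: H => [[e fe]|H]; first by do 3!right; left; apply: frame_iso fe.
    case: H => [[a [a0 [e fe]]]|H].
      by do 4!right; left; exists a; split=> //; apply: frame_iso fe.
    case: H => [[e fe]|[a [a0 [e fe]]]].
      by do 5!right; left; apply: frame_iso fe.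
    by do 6!right; exists a; split=> //; apply: frame_iso fe.
  suff [e [T [J [_ ?]]]] : exists (e : 6.-tuple g) T, adapted_by e T by exists J.
  case: H => [/frame_of_iso[e /adapted_4_6]|H]; first by exists e; eexists; eassumption.
  case: H => [/frame_of_iso[e /adapted_4_7]|H]; first by exists e; eexists; eassumption.
  case: H => [/frame_of_iso[e /adapted_5_16]|H]; first by exists e; eexists; eassumption.
  case: H => [/frame_of_iso[e /adapted_6_25]|H]; first by exists e; eexists; eassumption.
  case: H => [[a [a0 /frame_of_iso[e /(adapted_6_51 (lt0r_neq0 a0))]]]|H].
    by exists e; eexists; eassumption.
  case: H => [/frame_of_iso[e /adapted_6_158]|H]; first by exists e; eexists; eassumption.
  case: H => [a [a0 /frame_of_iso[e /(adapted_6_164 (lt0r_neq0 a0))]]].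
  by exists e; eexists; eassumption.
split.
  have [J [JT ad]] := adapted_std (fun e => @adapted_4_6 R (s_4_6_R2 R) e).
  exists J; split=> //; compute_J JT.
split.
  have [J [JT ad]] := adapted_std (fun e => @adapted_4_7 R (s_4_7_R2 R) e).
  exists J; split=> //; compute_J JT.
split.
  have [J [JT ad]] := adapted_std (fun e => @adapted_5_16 R (s_5_16_R R) e).
  exists J; split=> //; compute_J JT.
split.
  have [J [JT ad]] := adapted_std (fun e => @adapted_6_25 R (s_6_25 R) e).
  exists J; split=> //; compute_J JT.
split.
  move=> a a0.
  have [J [JT ad]] := adapted_std (fun e => @adapted_6_51 R (s_6_51 a) e a (lt0r_neq0 a0)).
  exists J; split=> //; compute_J JT.
split.
  have [J [JT ad]] := adapted_std (fun e => @adapted_6_158 R (s_6_158 R) e).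
  exists J; split=> //; compute_J JT.
move=> a a0.
have [J [JT ad]] := adapted_std (fun e => @adapted_6_164 R (s_6_164 a) e a (lt0r_neq0 a0)).
exists J; split=> //; compute_J JT.
Qed.
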